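(* Let $\mathbf{g}\in\mathbb{R}^d$ have non-zero entries, let $\epsilon>0$, and let $\mathsf{LN}:\mathbb{R}^d\to\mathbb{R}^d$ be $$\mathsf{LN}(\mathbf{x})=\frac{\mathbf{g}\odot\mathbf{y}}{\sqrt{\|\mathbf{y}\|_2^2+\epsilon}},\qquad \mathbf{y}=(\mathbf{I}_d-\tfrac1d\mathbf{1}\mathbf{1}^\top)\mathbf{x}.$$ Let $\mathbf{x}\in\mathbb{R}^d$ and let $\mathbf{y}$ be as in this formula. The normwise condition numbers of $\mathsf{LN}$ satisfy $$\kappa_{2,2}(\mathsf{LN},\mathbf{x})\le\frac{\|\mathbf{g}\|_\infty\|\mathbf{x}\|_2}{\|\mathbf{g}\odot\mathbf{y}\|_2},$$ $$\kappa_{2,\infty}(\mathsf{LN},\mathbf{x})=\max_{1\le i\le d}|g_i|\sqrt{1-\frac1d-\Big(1+\frac{\epsilon}{\|\mathbf{y}\|_2^2+\epsilon}\Big)\frac{y_i^2}{\|\mathbf{y}\|_2^2+\epsilon}}\;\frac{\|\mathbf{x}\|_2}{\|\mathbf{g}\odot\mathbf{y}\|_\infty},$$ $$\kappa_{\infty,2}(\mathsf{LN},\mathbf{x})\le\max_{\mathbf{v}\in\{-1,1\}^d}\sqrt{d-\frac{(\mathbf{v}^\top\mathbf{1})^2}{d}-\Big(1+\frac{\epsilon}{\|\mathbf{y}\|_2^2+\epsilon}\Big)\frac{(\mathbf{v}^\top\mathbf{y})^2}{\|\mathbf{y}\|_2^2+\epsilon}}\;\frac{\|\mathbf{g}\|_\infty\|\mathbf{x}\|_\infty}{\|\mathbf{g}\odot\mathbf{y}\|_2},$$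 $$\kappa_{\infty,\infty}(\mathsf{LN},\mathbf{x})=\max_{1\le i\le d}|g_i|\Big(1-\frac1d-\frac{y_i^2}{\|\mathbf{y}\|_2^2+\epsilon}+\sum_{j\ne i}\Big|\frac1d+\frac{y_iy_j}{\|\mathbf{y}\|_2^2+\epsilon}\Big|\Big)\frac{\|\mathbf{x}\|_\infty}{\|\mathbf{g}\odot\mathbf{y}\|_\infty},$$ its mixed condition numbers satisfy $$\kappa_{c,\infty}(\mathsf{LN},\mathbf{x})=\max_{1\le i\le d}|g_i|\Big(\Big[1-\frac1d-\frac{y_i^2}{\|\mathbf{y}\|_2^2+\epsilon}\Big]|x_i|+\sum_{j\ne i}\Big|\frac1d+\frac{y_iy_j}{\|\mathbf{y}\|_2^2+\epsilon}\Big||x_j|\Big)\frac{1}{\|\mathbf{g}\odot\mathbf{y}\|_\infty},$$ $$\kappa_{\infty,c}(\mathsf{LN},\mathbf{x})=\max_{1\le i\le d}\Big(\frac{d-1}{d|y_i|}-\frac{|y_i|}{\|\mathbf{y}\|_2^2+\epsilon}+\sum_{j\ne i}\Big|\frac{1}{dy_i}+\frac{y_j}{\|\mathbf{y}\|_2^2+\epsilon}\Big|\Big)\|\mathbf{x}\|_\infty,$$ $$\kappa_{c,2}(\mathsf{LN},\mathbf{x})\le\max_{\mathbf{v}\in\{-1,1\}^d}\sqrt{\|\mathbf{x}\|_2^2-\frac{(\mathbf{v}^\top\mathbf{x})^2}{d}-\Big(1+\frac{\epsilon}{\|\mathbf{y}\|_2^2+\epsilon}\Big)\frac{(\mathbf{v}^\top(\mathbf{y}\odot\mathbf{x}))^2}{\|\mathbf{y}\|_2^2+\epsilon}}\;\frac{\|\mathbf{g}\|_\infty}{\|\mathbf{g}\odot\mathbf{y}\|_2},$$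 $$\kappa_{2,c}(\mathsf{LN},\mathbf{x})=\sqrt{\frac{d-1}{d\|\mathbf{y}\|_{-\infty}^2}-\Big(1+\frac{\epsilon}{\|\mathbf{y}\|_2^2+\epsilon}\Big)\frac{1}{\|\mathbf{y}\|_2^2+\epsilon}}\;\|\mathbf{x}\|_2,$$ and its componentwise condition number equals $$\kappa_{c,c}(\mathsf{LN},\mathbf{x})=\max_{1\le i\le d}\Big(\Big[\frac{d-1}{d|y_i|}-\frac{|y_i|}{\|\mathbf{y}\|_2^2+\epsilon}\Big]|x_i|+\sum_{j\ne i}\Big|\frac{1}{dy_i}+\frac{y_j}{\|\mathbf{y}\|_2^2+\epsilon}\Big||x_j|\Big).$$ The inequalities become equalities when $\mathbf{g}=g\mathbf{1}$ for a scalar $g$.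
   Context: $\odot$ is the entrywise (Hadamard) product, $\mathbf{1}$ the all-ones vector, $\|\mathbf{y}\|_{-\infty}=\min_i|y_i|$. Condition numbers: for vectors $\hat{\mathbf w},\mathbf w$ put $\rho_p(\hat{\mathbf w},\mathbf w)=\|\hat{\mathbf w}-\mathbf w\|_p/\|\mathbf w\|_p$ ($1\le p\le\infty$) and $\rho_c(\hat{\mathbf w},\mathbf w)=\max_i|(\hat w_i-w_i)/w_i|$, with the conventions $a/0=\infty$ for $a\ne0$ and $0/0=0$. For a function $f$ between Euclidean spaces, a point $\mathbf v$, and $\theta_{in},\theta_{out}\in[1,\infty]\cup\{c\}$, $$\kappa_{\theta_{in},\theta_{out}}(f,\mathbf v)=\lim_{t\to0}\sup\Big\{\frac{\rho_{\theta_{out}}(f(\hat{\mathbf v}),f(\mathbf v))}{\rho_{\theta_{in}}(\hat{\mathbf v},\mathbf v)}:\rho_{\theta_{in}}(\hat{\mathbf v},\mathbf v)\le t\Big\},$$ where $\hat{\mathbf v}=\mathbf v$ is allowed. Condition numbers may be infinite.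
   Formalization: For g = g1, equality in the κ_{2,2} bound is claimed only if d ≥ 3, or d = 2 and y = 0, or x = 0; it fails otherwise (for d = 2, y ≠ 0, κ_{2,2} is ε/(‖y‖²+ε) times the bound). Conventions: ∞·0 = 0, and for d = 1 the root of the negative radicand in κ_{2,c} is 0. *)

(* Defs.v *)
From mathcomp Require Import all_boot all_order all_algebra.
From mathcomp Require Import all_classical all_reals all_analysis.

Set Implicit Arguments.
Unset Strict Implicit.
Unset Printing Implicit Defensive.

Import Order.TTheory GRing.Theory Num.Theory.
Import numFieldNormedType.Exports.

Local Open Scope classical_set_scope.
Local Open Scope ring_scope.

(* Quotients that may degenerate are computed in \bar R. The library has
   0^-1 = +oo and 0 * +oo = 0 there, so that `|a%:E / 0|%E is +oo for a != 0
   and 0 for a = 0. *)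

Definition dot (R : realType) (n : nat) (u v : 'cV[R]_n) : R := (u^T *m v) 0 0.

Definition hadamard (R : realType) (n : nat) (u v : 'cV[R]_n) : 'cV[R]_n :=
  map2_mx *%R u v.

Definition ones (R : realType) (n : nat) : 'cV[R]_n := const_mx 1.
Arguments ones {R n}.

Definition pnorm (R : realType) (p : R) (n : nat) (v : 'cV[R]_n) : R :=
  (\sum_(i < n) `|v i 0| `^ p) `^ p^-1.

Definition norm2 (R : realType) (n : nat) (v : 'cV[R]_n) : R := pnorm 2 v.

Definition norm_inf (R : realType) (n : nat) (v : 'cV[R]_n) : R :=
  \big[Num.max/0]_(i < n) `|v i 0|.

(* ||v||_{-oo}; finite as soon as 0 < n. *)
Definition norm_minf (R : realType) (n : nat) (v : 'cV[R]_n) : \bar R :=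
  \big[mine/+oo%E]_(i < n) `|v i 0|%:E.

(* The elements of {-1, 1}^n are the vectors signs b. *)
Definition signs (R : realType) (n : nat) (b : {ffun 'I_n -> bool}) :
    'cV[R]_n :=
  \col_i (-1) ^+ b i.
Arguments signs {R n} b.

(* The index set [1, oo] u {c}; Lp p is meant for 1 <= p. *)
Inductive theta (R : realType) := Lp of R | Linf | Comp.
Arguments Linf {R}.
Arguments Comp {R}.

Definition rho (R : realType) (th : theta R) (n : nat) (w' w : 'cV[R]_n) :
    \bar R :=
  match th with
  | Lp p => ((pnorm p (w' - w))%:E / (pnorm p w)%:E)%E
  | Linf => ((norm_inf (w' - w))%:E / (norm_inf w)%:E)%E
  | Comp => (\big[maxe/0]_(i < n) `|(w' i 0 - w i 0)%:E / (w i 0)%:E|)%E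
  end.

Definition kappa (R : realType) (thin thout : theta R) (m n : nat)
    (f : 'cV[R]_m -> 'cV[R]_n) (v : 'cV[R]_m) : \bar R :=
  lim (ereal_sup [set (rho thout (f v') (f v) / rho thin v' v)%E
                 | v' in [set v' | (rho thin v' v <= t%:E)%E]]
       @[t --> 0^'+]).

Definition centered (R : realType) (d : nat) (x : 'cV[R]_d) : 'cV[R]_d :=
  (1%:M - d%:R^-1 *: (ones *m ones^T)) *m x.

Definition LN (R : realType) (d : nat) (g : 'cV[R]_d) (eps : R)
    (x : 'cV[R]_d) : 'cV[R]_d :=
  let y := centered x in
  (Num.sqrt (norm2 y ^+ 2 + eps))^-1 *: hadamard g y.

(* Main.v *)
Require Import Defs.
From mathcomp Require Import all_boot all_order all_algebra.
From mathcomp Require Import all_classical all_reals all_analysis.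
From mathcomp Require Import ring lra.

Set Implicit Arguments.
Unset Strict Implicit.
Unset Printing Implicit Defensive.

Import Order.TTheory GRing.Theory Num.Theory.
Import numFieldNormedType.Exports.

Local Open Scope classical_set_scope.
Local Open Scope ring_scope.

(** The supremum defining kappa is monotone in the radius, so kappa is an infimum
    over radii, and if both relative errors are norms after a diagonal rescaling
    (sigma of the input, tau of the output) it is the operator norm of the
    rescaled Jacobian. The Jacobian of LN is diag(g) A / sqrt s, where
    A = I - 11^T/d - yy^T/s is symmetric and A^2 = I - 11^T/d - (1 + eps/s) yy^T/s.
    Operator norms into the max-norm are the largest dual norm of a row; the norm
    from the max-norm into the 2-norm is attained at a sign vector by convexity;
    and A is a contraction for the 2-norm which fixes the vectors orthogonal to
    1 and y. If x = 0 or d = 1 the output error vanishes, and if the output has a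
    zero where the error is relative, kappa is infinite. *)

(** * Norms *)

Section Norms.
Context {R : realType}.

(** The obstacle is degeneracy: the formulas are identities in the extended reals and have to hold
    at every [x], also where [x], [y] or single coordinates vanish. On the input side a zero of [x]
    makes the rescaling [sigma] singular. Coordinates of the parameter are then lost and its norm
    only bounds the input error from above, which suffices because a smaller input error enlarges
    the ratio. On the output side a zero cannot be rescaled away and is treated apart. The
    linearisation uses an explicit quadratic remainder, uniform near [x]; it exists because
    [eps > 0] keeps the radicand away from zero. The rank-one term yy^T/s has trace [(s - eps) / s]
    rather than 1, which is the origin of the factor [1 + eps / s]. From the 2-norm to the 2-norm
    with constant [g], the bound is reached along a nonzero vector orthogonal to both 1 and [y]. For
    [y != 0] such a vector exists only if [2 < d], hence the side condition on that equality. *)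

Lemma cauchy_schwarz_sum (I : finType) (a b : I -> R) :
  (\sum_i a i * b i) ^+ 2 <= (\sum_i a i ^+ 2) * (\sum_i b i ^+ 2).
Proof.
have [b0|] := eqVneq (\sum_i b i ^+ 2) 0.
  have bi0 i : b i = 0.
    have /psumr_eq0P := b0 => /(_ (fun i _ => sqr_ge0 (b i))) /(_ i isT).
    by move/eqP; rewrite sqrf_eq0 => /eqP.
  by rewrite b0 mulr0 big1 ?expr0n// => i _; rewrite bi0 mulr0.
set A := \sum_i a i ^+ 2; set B := \sum_i b i ^+ 2.
set D := \sum_i a i * b i => B0.
have Bgt0 : 0 < B by rewrite lt_def B0 sumr_ge0// => i _; apply: sqr_ge0.
have : 0 <= \sum_i (B * a i - D * b i) ^+ 2 by apply: sumr_ge0 => i _; apply: sqr_ge0.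
have -> : \sum_i (B * a i - D * b i) ^+ 2 = B * (A * B - D ^+ 2).
  transitivity (\sum_i (B ^+ 2 * a i ^+ 2 - 2 * B * D * (a i * b i)
                        + D ^+ 2 * b i ^+ 2)).
    by apply: eq_bigr => i _; ring.
  rewrite big_split sumrB -!mulr_sumr -/A -/B -/D /=; ring.
by rewrite pmulr_rge0// subr_ge0.
Qed.

Lemma norm2E n (v : 'cV[R]_n) : norm2 v = Num.sqrt (\sum_i v i 0 ^+ 2).
Proof.
rewrite /norm2 /pnorm powR12_sqrt.
  congr (Num.sqrt _); apply: eq_bigr => i _.
  by rewrite powR_mulrn// real_normK// num_real.
by apply: sumr_ge0 => i _; apply: powR_ge0.
Qed.

Lemma sum_sqr_ge0 n (v : 'cV[R]_n) : 0 <= \sum_i v i 0 ^+ 2.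
Proof. by apply: sumr_ge0 => i _; apply: sqr_ge0. Qed.

Lemma norm2_sqr n (v : 'cV[R]_n) : norm2 v ^+ 2 = \sum_i v i 0 ^+ 2.
Proof. by rewrite norm2E sqr_sqrtr// sum_sqr_ge0. Qed.

Lemma norm2_ge0 n (v : 'cV[R]_n) : 0 <= norm2 v.
Proof. by rewrite norm2E sqrtr_ge0. Qed.

Lemma norm_inf_ge0 n (v : 'cV[R]_n) : 0 <= norm_inf v.
Proof. by rewrite /norm_inf; elim/big_ind: _ => // a b a0 b0; rewrite le_max a0. Qed.

Lemma norm2_leP n (v : 'cV[R]_n) (m : R) : 0 <= m ->
  (norm2 v <= m) = (\sum_i v i 0 ^+ 2 <= m ^+ 2).
Proof. by move=> m0; rewrite -norm2_sqr ler_sqr// nnegrE norm2_ge0. Qed.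

Lemma norm_inf_leP n (v : 'cV[R]_n) (m : R) : 0 <= m ->
  reflect (forall i, `|v i 0| <= m) (norm_inf v <= m).
Proof.
move=> m0; apply: (iffP (bigmax_leP _ _ _ _)) => [[_ H] i|H]; first exact: H.
by split.
Qed.

Lemma le_norm_inf n (v : 'cV[R]_n) i : `|v i 0| <= norm_inf v.
Proof. by move: i; apply/norm_inf_leP; rewrite ?norm_inf_ge0. Qed.

(** The last two clauses compare [N] with the largest modulus of a coordinate, in both directions.
    They supply definiteness, and they let a remainder that is bounded coordinatewise be measured in
    any [N]. *)
Definition is_norm n (N : 'cV[R]_n -> R) : Prop :=
  [/\ forall u v : 'cV[R]_n, N (u + v) <= N u + N v,
      forall (c : R) (u : 'cV[R]_n), N (c *: u) = `|c| * N u,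
      forall (u : 'cV[R]_n) i, `|u i 0| <= N u
    & exists2 C, 0 <= C & forall (u : 'cV[R]_n) m, 0 <= m ->
        (forall i, `|u i 0| <= m) -> N u <= C * m].

Lemma norm_inf_is_norm n : is_norm (@norm_inf R n).
Proof.
split.
- move=> u v; apply/norm_inf_leP; first by rewrite addr_ge0 ?norm_inf_ge0.
  by move=> i; rewrite mxE (le_trans (ler_normD _ _))// lerD ?le_norm_inf.
- move=> c u; rewrite /norm_inf -{1}(mulr0 `|c|).
  rewrite (big_morph _ (fun a b => maxr_pMr a b (normr_ge0 c)) (mulr0 _)) mulr0.
  by apply: eq_bigr => i _; rewrite mxE normrM.
- exact: le_norm_inf.
- by exists 1 => // u m m0 H; rewrite mul1r; apply/norm_inf_leP.
Qed.

Lemma norm2Z n c (u : 'cV[R]_n) : norm2 (c *: u) = `|c| * norm2 u.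
Proof.
rewrite !norm2E -sqrtr_sqr -sqrtrM ?sqr_ge0// mulr_sumr.
by congr Num.sqrt; apply: eq_bigr => i _; rewrite mxE exprMn.
Qed.

Lemma dot_sum n (u v : 'cV[R]_n) : dot u v = \sum_i u i 0 * v i 0.
Proof. by rewrite /dot mxE; apply: eq_bigr => i _; rewrite mxE. Qed.

Lemma dotC n (u v : 'cV[R]_n) : dot u v = dot v u.
Proof. by rewrite !dot_sum; apply: eq_bigr => i _; rewrite mulrC. Qed.

Lemma dot_le_norm2 n (u v : 'cV[R]_n) : `|dot u v| <= norm2 u * norm2 v.
Proof.
have aux (a b A B D : R) : 0 <= a -> 0 <= b -> a ^+ 2 = A -> b ^+ 2 = B ->
    D ^+ 2 <= A * B -> `|D| <= a * b.
  move=> a0 b0 <- <- H.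
  by rewrite -ler_sqr ?nnegrE ?mulr_ge0// real_normK ?num_real// exprMn.
apply: aux (norm2_ge0 u) (norm2_ge0 v) (norm2_sqr u) (norm2_sqr v) _.
rewrite dot_sum; exact: cauchy_schwarz_sum.
Qed.

Lemma norm2_dot n (u : 'cV[R]_n) : norm2 u ^+ 2 = dot u u.
Proof. by rewrite norm2_sqr dot_sum; apply: eq_bigr => i _; rewrite expr2. Qed.

Lemma norm2_is_norm n : is_norm (@norm2 R n).
Proof.
split.
- move=> u v.
  have aux (a b c A B C D : R) : 0 <= a -> 0 <= b -> 0 <= c ->
      a ^+ 2 = A -> b ^+ 2 = B -> c ^+ 2 = C ->
      C = A + D *+ 2 + B -> `|D| <= a * b -> c <= a + b.
    move=> a0 b0 c0 <- <- cC CE /(le_trans (ler_norm _)) H.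
    rewrite -ler_sqr ?nnegrE ?addr_ge0// cC CE sqrrD.
    by rewrite lerD2r lerD2l lerMn2r.
  apply: aux (norm2_ge0 u) (norm2_ge0 v) (norm2_ge0 (u + v))
    (norm2_sqr u) (norm2_sqr v) (norm2_sqr (u + v)) _ (dot_le_norm2 u v).
  rewrite dot_sum -sumrMnl -!big_split; apply: eq_bigr => i _.
  by rewrite mxE sqrrD.
- exact: norm2Z.
- move=> u i; rewrite -ler_sqr ?nnegrE ?norm2_ge0// norm2_sqr real_normK ?num_real//.
  by rewrite (bigD1 i)//= lerDl sumr_ge0// => j _; apply: sqr_ge0.
- exists (Num.sqrt n%:R); first exact: sqrtr_ge0.
  move=> u m m0 H; rewrite norm2_leP ?mulr_ge0 ?sqrtr_ge0//.
  rewrite exprMn sqr_sqrtr ?ler0n// mulr_natl -[X in _ *+ X]card_ord -sumr_const.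
  by apply: ler_sum => i _; rewrite -(real_normK (num_real _)) ler_sqr ?nnegrE.
Qed.

Lemma is_norm_ge0 n (N : 'cV[R]_n -> R) : is_norm N -> (0 < n)%N -> forall u, 0 <= N u.
Proof.
by case=> _ _ N3 _ n0 u; apply: le_trans (N3 u (Ordinal n0)).
Qed.

End Norms.

(** * Condition numbers as infima *)

Section ConditionNumber.
Context {R : realType}.
Variables (thin thout : theta R) (m n : nat).
Variables (f : 'cV[R]_m -> 'cV[R]_n) (v : 'cV[R]_m).

Definition error_ratio (v' : 'cV[R]_m) : \bar R :=
  (rho thout (f v') (f v) / rho thin v' v)%E.

Definition error_ratio_sup (t : R) : \bar R :=
  ereal_sup [set error_ratio v' | v' in [set v' | (rho thin v' v <= t%:E)%E]].

Lemma kappaE :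
  kappa thin thout f v = ereal_inf [set error_ratio_sup t | t in [set t : R | 0 < t]].
Proof.
apply/cvg_lim => //; rewrite -/error_ratio_sup.
have -> : [set t : R | 0 < t] = [set` Interval (BRight (0 : R)) (BInfty R false)].
  by apply/seteqP; split => t /=; rewrite in_itv/= andbT.
apply: nondecreasing_at_right_cvge => //.
move=> s t _ _ st; apply: ereal_sup_le; apply: image_subset => v' /= H.
by apply: le_trans H _; rewrite lee_fin.
Qed.

(** The radius may depend on the slack [e], which leaves room for the second-order remainder of a
    linearisation. *)
Lemma kappa_le (K : R) :
  (forall e, 0 < e -> exists2 t, 0 < t & forall v', (rho thin v' v <= t%:E)%E ->
     (error_ratio v' <= (K + e)%:E)%E) ->
  (kappa thin thout f v <= K%:E)%E.
Proof.
move=> H; apply/lee_addgt0Pr => e /H[t t0 Ht]; rewrite kappaE.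
apply: ge_ereal_inf; exists (error_ratio_sup t); first by exists t.
apply: ge_ereal_sup => _ [v' /= v'v <-]; rewrite -EFinD; exact: Ht.
Qed.

Lemma kappa_ge (K : R) :
  (forall t e, 0 < t -> 0 < e -> exists2 v', (rho thin v' v <= t%:E)%E &
     (K%:E <= error_ratio v' + e%:E)%E) ->
  (K%:E <= kappa thin thout f v)%E.
Proof.
move=> H; rewrite kappaE; apply: le_ereal_inf_tmp => _ [t /= t0 <-].
apply/lee_addgt0Pr => e e0; have [v' v'v Kv'] := H _ _ t0 e0.
apply: le_trans Kv' _; apply: leeD2r; apply: ereal_sup_ubound.
by exists v'.
Qed.

Lemma kappa_pinfty :
  (forall t, 0 < t -> exists2 v', (rho thin v' v <= t%:E)%E & error_ratio v' = +oo%E) ->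
  kappa thin thout f v = +oo%E.
Proof.
move=> H; apply/eqP; rewrite kappaE -leye_eq; apply: le_ereal_inf_tmp => _ [t /= t0 <-].
have [v' v'v <-] := H _ t0.
by apply: ereal_sup_ubound; exists v'.
Qed.

(** The condition on [rho thin v v] keeps [v] itself in every ball, so that no supremum is taken
    over the empty set, where it would be -oo. *)
Lemma kappa_const (r : R) : 0 < r -> (rho thin v v <= 0)%E ->
  (forall v', (rho thin v' v <= r%:E)%E -> rho thout (f v') (f v) = 0%E) ->
  kappa thin thout f v = 0%E.
Proof.
move=> r0 vv H; apply/eqP; rewrite eq_le; apply/andP; split.
  apply: kappa_le => e e0; exists r => // v' /H.
  by rewrite /error_ratio => ->; rewrite mul0e lee_fin add0r ltW.
apply: kappa_ge => t e t0 e0; exists v.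
  by apply: le_trans vv _; rewrite lee_fin ltW.
rewrite /error_ratio H ?mul0e ?add0e ?lee_fin ?(ltW e0)//.
by apply: le_trans vv _; rewrite lee_fin ltW.
Qed.

End ConditionNumber.

(** * Condition numbers as operator norms *)

Section OperatorNorm.
Context {R : realType}.

(** If [b = 0], the hypothesis forces [a = 0] and the convention 0/0 = 0 applies. *)
Lemma divE_le (a b k : R) : 0 <= a -> 0 <= b -> 0 <= k -> a <= k * b ->
  (a%:E / b%:E <= k%:E)%E.
Proof.
move=> a0 b0 k0 H; rewrite inver; case: eqVneq => [b00|bn0].
  have -> : a = 0 by apply/eqP; rewrite eq_le a0 andbT -(mulr0 k) -b00.
  by rewrite mul0e lee_fin.
by rewrite -EFinM lee_fin ler_pdivrMr// lt_def bn0.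
Qed.

Lemma divE_ge (a b c : R) : 0 <= a -> 0 <= b -> b <= c -> 0 < c ->
  ((a / c)%:E <= a%:E / b%:E)%E.
Proof.
move=> a0 b0 bc c0; rewrite inver; case: eqVneq => [_|bn0].
  have [->|an0] := eqVneq a 0; first by rewrite mul0r mul0e.
  by rewrite gt0_muley ?leey// lte_fin lt_def an0.
have b1 : 0 < b by rewrite lt_def bn0.
by rewrite -EFinM lee_fin ler_wpM2l// lef_pV2.
Qed.

(** The points at finite relative distance from [x] are parametrised by [u]. The second clause is
    only an inequality: where [sigma] vanishes, [u] does not move the point but still counts in
    [N u]. The first clause provides some parameter whose norm is the exact error. *)
Definition rho_param th n (x : 'cV[R]_n) (N : 'cV[R]_n -> R) (sigma : 'cV[R]_n) :=
  (forall v' (t : R), (rho th v' x <= t%:E)%E ->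
     exists2 u, v' = x + hadamard sigma u & rho th v' x = (N u)%:E) /\
  (forall u, (rho th (x + hadamard sigma u) x <= (N u)%:E)%E).

(** In contrast to the input side, the equality is required for all [w']; this is available only
    where the denominators of the error are nonzero. *)
Definition rho_scaled th n (w : 'cV[R]_n) (N : 'cV[R]_n -> R) (tau : 'cV[R]_n) :=
  forall w', rho th w' w = (N (hadamard tau (w' - w)))%:E.

(** Differentiability at [x] with a uniform quadratic remainder. It is stated coordinatewise, so
    that it does not depend on the norms in which the errors are measured. *)
Definition quad_approx m n (f : 'cV[R]_m -> 'cV[R]_n) (x : 'cV[R]_m)
    (J : 'M[R]_(n, m)) :=
  exists2 C, 0 <= C & forall (h : 'cV[R]_m) r, 0 <= r -> r <= 1 ->
    (forall i, `|h i 0| <= r) ->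
    forall i, `|(f (x + h) - f x - J *m h) i 0| <= C * r ^+ 2.

Lemma hadamardD n (t u w : 'cV[R]_n) :
  hadamard t (u + w) = hadamard t u + hadamard t w.
Proof. by apply/matrixP => i j; rewrite !mxE mulrDr. Qed.

Lemma hadamardZ n (t u : 'cV[R]_n) c : hadamard t (c *: u) = c *: hadamard t u.
Proof. by apply/matrixP => i j; rewrite !mxE mulrCA. Qed.

Lemma hadamard0 n (t : 'cV[R]_n) : hadamard t 0 = 0.
Proof. by apply/matrixP => i j; rewrite !mxE mulr0. Qed.

Variables (thin thout : theta R) (m n : nat).
Variables (f : 'cV[R]_m -> 'cV[R]_n) (x : 'cV[R]_m) (J : 'M[R]_(n, m)).
Variables (Nin : 'cV[R]_m -> R) (Nout : 'cV[R]_n -> R).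
Variables (sigma : 'cV[R]_m) (tau : 'cV[R]_n).
Hypotheses (m_gt0 : (0 < m)%N) (n_gt0 : (0 < n)%N).
Hypotheses (Nin_norm : is_norm Nin) (Nout_norm : is_norm Nout).
Hypotheses (rho_in : rho_param thin x Nin sigma).
Hypotheses (rho_out : rho_scaled thout (f x) Nout tau).
Hypothesis (f_approx : quad_approx f x J).

Let L u := hadamard tau (J *m hadamard sigma u).

Let approx : exists2 D, 0 <= D & exists2 r, 0 < r & forall u, Nin u <= r ->
  exists2 w, hadamard tau (f (x + hadamard sigma u) - f x) = L u + w &
    Nout w <= D * Nin u ^+ 2.
Proof.
have [C C0 HC] := f_approx; have [_ _ _ [C' C'0 HC']] := Nout_norm.
set S := norm_inf sigma; set T := norm_inf tau.
have S0 : 0 <= S := norm_inf_ge0 _; have T0 : 0 <= T := norm_inf_ge0 _.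
exists (C' * (T * (C * S ^+ 2))); first by rewrite !mulr_ge0 ?exprn_ge0.
(* [S] is the max-norm of [sigma], so this radius keeps the coordinates of [hadamard sigma u] below
   1 as [quad_approx] requires; the added 1 covers [S = 0]. *)
exists (S + 1)^-1; first by rewrite invr_gt0; lra.
move=> u ur; have u0 : 0 <= Nin u by apply: is_norm_ge0.
exists (hadamard tau (f (x + hadamard sigma u) - f x - J *m hadamard sigma u)).
  by rewrite /L -hadamardD [in RHS]addrC subrK.
have -> : C' * (T * (C * S ^+ 2)) * Nin u ^+ 2 =
    C' * (T * (C * (S * Nin u) ^+ 2)) by ring.
apply: HC'; first by rewrite !mulr_ge0 ?exprn_ge0.
move=> i; rewrite mxE normrM; apply: ler_pM => //; first exact: le_norm_inf.
apply: HC; first exact: mulr_ge0.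
  have : S * Nin u <= S * (S + 1)^-1 by rewrite ler_wpM2l.
  move=> /le_trans; apply; rewrite ler_pdivrMr ?mul1r; lra.
have [_ _ N3 _] := Nin_norm.
by move=> j; rewrite mxE normrM ler_pM// le_norm_inf.
Qed.

Lemma kappa_le_opnorm (K : R) : 0 <= K ->
  (forall u, Nout (L u) <= K * Nin u) -> (kappa thin thout f x <= K%:E)%E.
Proof.
move=> K0 HK; have [D D0 [r r0 Dr]] := approx; have [N1 _ _ _] := Nout_norm.
(* For [Nin u <= e / (D + 1)] the remainder [D * Nin u ^+ 2] is at most [e * Nin u]. *)
apply: kappa_le => e e0; exists (Num.min r (e / (D + 1))).
  by rewrite lt_min r0 divr_gt0//; lra.
move=> v' v't; have [u v'E rhoE] := rho_in.1 _ _ v't.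
move: v't; rewrite rhoE lee_fin le_min => /andP[ur ue].
have u0 : 0 <= Nin u by apply: is_norm_ge0.
rewrite /error_ratio. rewrite rho_out rhoE; apply: divE_le => //.
- exact: is_norm_ge0.
- by rewrite addr_ge0 // ltW.
rewrite v'E; have [w -> wD] := Dr _ ur.
apply: le_trans (N1 _ _) _; rewrite mulrDl lerD//; apply: le_trans wD _.
rewrite expr2 mulrA ler_wpM2r//.
apply: le_trans (ler_wpM2l D0 ue) _.
by rewrite mulrA ler_pdivrMr ?ler_wpM2r; nra.
Qed.

(** The direction [u] is shrunk to norm [c]. The linear part is then at least [K * c], and the
    remainder [D * c ^+ 2] is at most [e * c] by the choice of [c]. *)
Lemma kappa_ge_opnorm (K : R) u : 0 < Nin u -> K * Nin u <= Nout (L u) ->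
  (K%:E <= kappa thin thout f x)%E.
Proof.
have [D D0 [r r0 Dr]] := approx; have [N1 N2 _ _] := Nout_norm.
have [_ M2 _ _] := Nin_norm.
move=> u0 Ku; apply: kappa_ge => t e t0 e0.
pose c := Num.min (Num.min r t) (e / (D + 1)).
have c0 : 0 < c by rewrite !lt_min r0 t0 divr_gt0//; lra.
have [cr ct cD] : [/\ c <= r, c <= t & D * c <= e].
  split; [by rewrite !ge_min lexx|by rewrite !ge_min lexx orbT|].
  have : c <= e / (D + 1) by rewrite ge_min lexx orbT.
  by rewrite ler_pdivlMr; nra.
pose u' := (c / Nin u) *: u.
have u'E : Nin u' = c.
  by rewrite M2 ger0_norm ?divfK ?gt_eqF//; apply: divr_ge0; apply: ltW.
exists (x + hadamard sigma u').
  by apply: le_trans (rho_in.2 _) _; rewrite u'E lee_fin.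
have := rho_in.2 u'; rewrite u'E => rle.
(* The actual input error [Nin w] may be smaller than [c], even 0, when [sigma] has zeros; [divE_ge]
   replaces it by [c] at the end. *)
have [w _ rhoE] := rho_in.1 _ _ rle.
move: rle; rewrite rhoE lee_fin => wc.
rewrite /error_ratio rho_out rhoE.
have [z -> zD] : exists2 w, hadamard tau (f (x + hadamard sigma u') - f x) =
    L u' + w & Nout w <= D * c ^+ 2.
  by rewrite -u'E; apply: Dr; rewrite u'E.
have Lu' : c * K <= Nout (L u').
  rewrite /L hadamardZ -scalemxAr hadamardZ N2 -/(L u).
  rewrite ger0_norm; last by apply: divr_ge0; apply: ltW.
  by rewrite mulrAC ler_pdivlMr// -mulrA ler_wpM2l// ltW.
have LD : Nout (L u') <= Nout (L u' + z) + Nout z.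
  have := N1 (L u' + z) ((-1) *: z).
  by rewrite N2 scaleN1r addrK normrN1 mul1r.
have A0 : 0 <= Nout (L u' + z) by apply: is_norm_ge0.
have W0 : 0 <= Nin w by apply: is_norm_ge0.
apply: (@le_trans _ _ ((Nout (L u' + z) / c)%:E + e%:E)%E).
  rewrite -EFinD lee_fin -lerBlDr ler_pdivlMr//; nra.
by apply: leeD2r; apply: divE_ge.
Qed.

End OperatorNorm.

(** * The Jacobian of layer normalization *)

Section RelativeErrors.
Context {R : realType}.

Lemma is_norm0 n (N : 'cV[R]_n -> R) : is_norm N -> N 0 = 0.
Proof. by case=> _ N2 _ _; rewrite -[in LHS](scale0r 0) N2 normr0 mul0r. Qed.

Lemma is_norm_eq0 n (N : 'cV[R]_n -> R) u : is_norm N -> N u = 0 -> u = 0.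
Proof.
case=> _ _ N3 _ u0; apply/colP => i; rewrite mxE; apply/eqP.
by rewrite -normr_eq0 eq_le normr_ge0 andbT -u0.
Qed.

Lemma is_norm_gt0 n (N : 'cV[R]_n -> R) u : is_norm N -> (0 < n)%N -> u != 0 -> 0 < N u.
Proof.
move=> HN n0 u0; rewrite lt_def is_norm_ge0// andbT; apply: contra u0 => /eqP H.
by rewrite (is_norm_eq0 HN H).
Qed.

Lemma hadamard_const n c (u : 'cV[R]_n) : hadamard (const_mx c) u = c *: u.
Proof. by apply/colP => i; rewrite !mxE. Qed.

(** The scaling is the constant [N x]. At [x = 0] it vanishes, in agreement with the fact that only
    [x] itself is then at finite distance. *)
Lemma rho_param_norm th n (x : 'cV[R]_n) (N : 'cV[R]_n -> R) : (0 < n)%N ->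
  is_norm N -> (forall w, rho th w x = ((N (w - x))%:E / (N x)%:E)%E) ->
  rho_param th x N (const_mx (N x)).
Proof.
move=> n0 HN rhoE; have [_ N2 _ _] := HN; have N0 := is_norm_ge0 HN n0.
split=> [v' t|u].
  rewrite rhoE inver; case: eqVneq => [x0|xn0].
    have [v'x _|v'x] := eqVneq (N (v' - x)) 0.
      exists 0; last by rewrite v'x mul0e is_norm0.
      by rewrite hadamard0 addr0; apply/subr0_eq/(is_norm_eq0 HN).
    by rewrite gt0_muley ?leye_eq// lte_fin lt_def v'x N0.
  move=> _; exists ((N x)^-1 *: (v' - x)).
    by rewrite hadamard_const scalerA divff// scale1r addrC subrK.
  by rewrite N2 -EFinM mulrC ger0_norm// invr_ge0 N0.
rewrite rhoE (addrC x) addrK hadamard_const N2 ger0_norm//.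
by apply: divE_le; rewrite ?mulr_ge0// mulrC.
Qed.

Lemma rho_param_comp n (x : 'cV[R]_n) : rho_param Comp x (@norm_inf R n) x.
Proof.
split=> [v' t|u].
  move=> /= /bigmax_leP[_ H].
  have H1 i : x i 0 = 0 -> v' i 0 = 0.
    move=> xi0; apply/eqP; apply: contraT => v'i.
    have := H i isT; rewrite xi0 subr0 inve0 abseM.
    by rewrite (_ : `|+oo%E|%E = +oo%E)// gt0_muley ?leye_eq//= lte_fin normr_gt0.
  (* A finite error forces [v'] to vanish wherever [x] does. In such a coordinate the field quotient
     is 0, which matches the convention 0/0 = 0. *)
  exists (\col_i ((v' i 0 - x i 0) / x i 0)).
    apply/colP => i; rewrite !mxE.
    have [xi0|xi0] := eqVneq (x i 0) 0; first by rewrite H1// xi0 mul0r addr0.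
    by rewrite mulrC divfK// addrC subrK.
  rewrite /norm_inf -EFin_bigmax; apply: eq_bigr => i _; rewrite mxE.
  have [xi0|xi0] := eqVneq (x i 0) 0.
    by rewrite H1// xi0 subr0 mul0e abse0 mul0r normr0.
  by rewrite inver (negbTE xi0) -EFinM.
apply/bigmax_leP; split; first by rewrite lee_fin norm_inf_ge0.
move=> i _; rewrite !mxE (addrC (x i 0)) addrK; apply: (@le_trans _ _ `|u i 0|%:E).
  have [->|xi0] := eqVneq (x i 0) 0; first by rewrite mul0r mul0e abse0 lee_fin.
  by rewrite inver (negbTE xi0) -EFinM mulrAC divff// mul1r.
by rewrite lee_fin le_norm_inf.
Qed.

Lemma rho_scaled_norm th n (w : 'cV[R]_n) (N : 'cV[R]_n -> R) :
  is_norm N -> (forall w', rho th w' w = ((N (w' - w))%:E / (N w)%:E)%E) ->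
  0 < N w -> rho_scaled th w N (const_mx (N w)^-1).
Proof.
move=> [_ N2 _ _] rhoE w0 w'; rewrite rhoE hadamard_const N2 inver gt_eqF//.
by rewrite -EFinM mulrC gtr0_norm// invr_gt0.
Qed.

Lemma rho_scaled_comp n (w : 'cV[R]_n) : (forall i, w i 0 != 0) ->
  rho_scaled Comp w (@norm_inf R n) (\col_i (w i 0)^-1).
Proof.
move=> w0 w'; rewrite /= /norm_inf -EFin_bigmax; apply: eq_bigr => i _.
by rewrite !mxE inver (negbTE (w0 i)) -EFinM mulrC.
Qed.

End RelativeErrors.

(** * Second-order expansion of layer normalization *)

Section LayerNorm.
Context {R : realType} {d : nat}.
Implicit Types (x y h u : 'cV[R]_d).

Let colD (u w : 'cV[R]_d) i : (u + w) i 0 = u i 0 + w i 0.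
Proof. by rewrite mxE. Qed.

Let colB (u w : 'cV[R]_d) i : (u - w) i 0 = u i 0 - w i 0.
Proof. by rewrite !mxE. Qed.

Lemma centeredE x i : centered x i 0 = x i 0 - d%:R^-1 * \sum_j x j 0.
Proof.
rewrite /centered mulmxBl mul1mx -scalemxAl !mxE; congr (_ - _ * _).
by apply: eq_bigr => j _; rewrite !mxE big_ord1 !mxE !mul1r.
Qed.

Lemma centeredD x h : centered (x + h) = centered x + centered h.
Proof. by rewrite /centered mulmxDr. Qed.

Lemma centeredZ c x : centered (c *: x) = c *: centered x.
Proof. by rewrite /centered -scalemxAr. Qed.

Lemma sum_centered x : (0 < d)%N -> \sum_i centered x i 0 = 0.
Proof.
move=> d0; under eq_bigr do rewrite centeredE.
rewrite sumrB sumr_const card_ord -[X in _ - X]mulr_natl mulrA divff ?mul1r ?subrr//.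
by rewrite pnatr_eq0 -lt0n.
Qed.

Lemma LNE (g : 'cV[R]_d) eps x i : LN g eps x i 0 =
  (Num.sqrt (\sum_j centered x j 0 ^+ 2 + eps))^-1 * (g i 0 * centered x i 0).
Proof.
rewrite /LN !mxE; congr ((Num.sqrt (_ + _))^-1 * _); exact: norm2_sqr.
Qed.

(** The matrix A of the overview when [y] is the centred input and [s] the radicand. *)
Definition ln_mx y (s : R) : 'M[R]_d :=
  \matrix_(i, j) ((i == j)%:R - d%:R^-1 - y i 0 * y j 0 / s).

Lemma ln_mxE y s u i :
  (ln_mx y s *m u) i 0 = centered u i 0 - y i 0 * dot y u / s.
Proof.
rewrite mxE centeredE dot_sum.
transitivity (\sum_j ((i == j)%:R * u j 0 - d%:R^-1 * u j 0
                      - y i 0 / s * (y j 0 * u j 0))).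
  by apply: eq_bigr => j _; rewrite mxE; ring.
rewrite !sumrB -!mulr_sumr; congr (_ - _ - _); last by ring.
rewrite (bigD1 i)//= eqxx mul1r big1 ?addr0// => j ji.
by rewrite eq_sym (negbTE ji) mul0r.
Qed.

Definition ln_jacobian (g : 'cV[R]_d) y (s : R) : 'M[R]_d :=
  \matrix_(i, j) ((Num.sqrt s)^-1 * g i 0 * ln_mx y s i j).

Lemma ln_jacobianE g y s u i : (ln_jacobian g y s *m u) i 0 =
  (Num.sqrt s)^-1 * g i 0 * (ln_mx y s *m u) i 0.
Proof.
rewrite !mxE mulr_sumr; apply: eq_bigr => j _.
by rewrite [in LHS]mxE mulrA.
Qed.

(** First- and second-order expansion of the inverse root when the radicand [s] grows by a linear
    part [2 * p] and a quadratic part [q]. Exact identities in the two roots [a] and [b] take the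
    place of Taylor's theorem, starting from [(b - a) * (b + a) = 2 * p + q]. Both radicands are at
    least [eps], so [M] bounds both inverse roots. *)
Lemma inv_sqrt_approx (eps P Q s p q r : R) : 0 < eps -> eps <= s ->
  eps <= s + 2 * p + q -> 0 <= P -> 0 <= r -> r <= 1 ->
  `|p| <= P * r -> 0 <= q -> q <= Q * r ^+ 2 ->
  let M := (Num.sqrt eps)^-1 in
  let a := Num.sqrt s in let b := Num.sqrt (s + 2 * p + q) in
  `|b^-1 - a^-1| <= (2 * P + Q) * M ^+ 3 * r /\
  `|b^-1 - a^-1 + p / a / s| <=
     ((2 * P + Q) ^+ 2 * M ^+ 5 * (3 / 2) + Q * M ^+ 3 / 2) * r ^+ 2.
Proof.
move=> eps0 s1 s2 P0 r0 r1 pP q0 qQ M a b.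
have a0 : 0 < a by rewrite sqrtr_gt0; lra.
have b0 : 0 < b by rewrite sqrtr_gt0; lra.
have e0 : 0 < Num.sqrt eps by rewrite sqrtr_gt0.
have M0 : 0 < M by rewrite invr_gt0.
have aM : a^-1 <= M by rewrite lef_pV2 ?posrE// ler_wsqrtr.
have bM : b^-1 <= M by rewrite lef_pV2 ?posrE// ler_wsqrtr.
have sE : s = a ^+ 2 by rewrite sqr_sqrtr//; lra.
have sE' : s + 2 * p + q = b ^+ 2 by rewrite sqr_sqrtr//; lra.
have Q0 : 0 <= Q * r ^+ 2 by lra.
set E := 2 * P + Q.
have dE : `|2 * p + q| <= E * r.
  have qr : q <= Q * r.
    apply: le_trans qQ _; rewrite expr2 mulrA -[leRHS]mulr1.
    have [->|rn0] := eqVneq r 0; first by rewrite !(mulr0, mul0r).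
    have r2 : 0 < r ^+ 2 by rewrite exprn_gt0// lt_def rn0.
    by rewrite ler_wpM2l// mulr_ge0//; rewrite -(pmulr_lge0 _ r2).
  rewrite /E (mulrDl (2 * P)); apply: le_trans (ler_normD _ _) _.
  rewrite lerD ?(ger0_norm q0)// normrM ger0_norm// -mulrA ler_wpM2l//.
have dab : (b - a) * (b + a) = 2 * p + q.
  have -> : 2 * p + q = b ^+ 2 - a ^+ 2 by rewrite -sE' -sE; ring.
  by ring.
have Dle : `|b - a| <= E * r * M.
  have -> : b - a = (2 * p + q) * (b + a)^-1 by rewrite -dab mulfK// gt_eqF ?addr_gt0.
  rewrite normrM ler_pM//.
  rewrite ger0_norm ?invr_ge0; last by rewrite addr_ge0// ltW.
  apply: le_trans aM; rewrite lef_pV2 ?posrE ?addr_gt0//; lra.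
have ai0 : 0 <= a^-1 by rewrite invr_ge0 ltW.
have bi0 : 0 <= b^-1 by rewrite invr_ge0 ltW.
have aXM k : a^-1 ^+ k <= M ^+ k by rewrite lerXn2r ?nnegrE// ltW.
have an0 : a != 0 by rewrite gt_eqF.
have bn0 : b != 0 by rewrite gt_eqF.
split.
  have -> : b^-1 - a^-1 = - (b - a) * (a^-1 * b^-1) by field; rewrite ?an0 ?bn0.
  rewrite normrM normrN (ger0_norm (mulr_ge0 _ _))//.
  have -> : E * M ^+ 3 * r = E * r * M * (M * M) by ring.
  by apply: (ler_pM (normr_ge0 _) (mulr_ge0 ai0 bi0) Dle); apply: ler_pM.
(* Once [p] is expressed by [b ^+ 2 - a ^+ 2 - q], the factorisation of
   [b ^+ 2 + a * b - 2 * a ^+ 2] as [(b - a) * (b + 2 * a)] produces the second factor [b - a]. *)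
have -> : b^-1 - a^-1 + p / a / s =
    (b - a) ^+ 2 * (a^-1 ^+ 3 / 2 + a^-1 ^+ 2 * b^-1) - q * a^-1 ^+ 3 / 2.
  have -> : p = ((b - a) * (b + a) - q) / 2 by rewrite dab; field.
  by rewrite sE; field; rewrite ?an0 ?bn0.
apply: le_trans (ler_normB _ _) _; rewrite mulrDl; apply: lerD.
  have -> : E ^+ 2 * M ^+ 5 * (3 / 2) * r ^+ 2 =
     (E * r * M) ^+ 2 * (M ^+ 3 / 2 + M ^+ 2 * M) by field.
  rewrite normrM normrX; apply: ler_pM => //.
    by rewrite ler_sqr ?nnegrE ?(le_trans _ Dle).
  rewrite ger0_norm; last by rewrite addr_ge0// ?mulr_ge0 ?exprn_ge0.
  apply: lerD; first by rewrite ler_wpM2r ?invr_ge0.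
  by apply: ler_pM; rewrite ?exprn_ge0.
rewrite ger0_norm ?mulr_ge0 ?exprn_ge0//.
have -> : Q * M ^+ 3 / 2 * r ^+ 2 = Q * r ^+ 2 * M ^+ 3 / 2 by ring.
rewrite ler_wpM2r ?invr_ge0//; by apply: ler_pM; rewrite ?exprn_ge0.
Qed.

Lemma LN_approx (g : 'cV[R]_d) eps x : (0 < d)%N -> 0 < eps ->
  quad_approx (LN g eps) x
    (ln_jacobian g (centered x) (\sum_j centered x j 0 ^+ 2 + eps)).
Proof.
move=> d0 eps0; set y := centered x; set s := _ + eps.
have epss : eps <= s by rewrite lerDr sum_sqr_ge0.
(* Coordinates of the centred increment are at most [2 * r]. This makes [P * r] a bound for its
   product with [y], and [Q * r ^+ 2] one for its squared norm. *)
pose P := 2 * \sum_j `|y j 0|; pose Q : R := 4 * d%:R.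
pose M := (Num.sqrt eps)^-1.
pose C1 := (2 * P + Q) * M ^+ 3.
pose C2 := (2 * P + Q) ^+ 2 * M ^+ 5 * (3 / 2) + Q * M ^+ 3 / 2.
have P0 : 0 <= P by rewrite mulr_ge0 ?sumr_ge0.
have Q0 : 0 <= Q by rewrite mulr_ge0 ?ler0n.
have M0 : 0 <= M by rewrite invr_ge0 sqrtr_ge0.
have E0 : 0 <= 2 * P + Q by rewrite addr_ge0// mulr_ge0.
have C10 : 0 <= C1 := mulr_ge0 E0 (exprn_ge0 3 M0).
have C20 : 0 <= C2.
  apply: addr_ge0; apply: mulr_ge0; rewrite ?divr_ge0 ?invr_ge0//.
    by apply: mulr_ge0; apply: exprn_ge0.
  by apply: mulr_ge0 => //; apply: exprn_ge0.
set G := norm_inf g; set Y := norm_inf y.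
have G0 : 0 <= G := norm_inf_ge0 _; have Y0 : 0 <= Y := norm_inf_ge0 _.
exists (G * (2 * C1 + Y * C2)).
  exact: mulr_ge0 G0 (addr_ge0 (mulr_ge0 (ler0n _ 2) C10) (mulr_ge0 Y0 C20)).
move=> h r r0 r1 hr i; set k := centered h.
have kr j : `|k j 0| <= 2 * r.
  rewrite centeredE; apply: le_trans (ler_normB _ _) _.
  have -> : 2 * r = r + r by ring.
  rewrite lerD// normrM ger0_norm ?invr_ge0// mulrC ler_pdivrMr ?ltr0n//.
  apply: le_trans (ler_norm_sum _ _ _) _.
  rewrite mulr_natr -[X in _ *+ X]card_ord -sumr_const.
  by apply: ler_sum => l _.
(* Since [y] sums to zero, centring the increment does not change its product with [y]; this is why
   the rank-one term of the Jacobian is symmetric. *)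
have yk : dot y k = dot y h.
  rewrite !dot_sum; under eq_bigr do rewrite (centeredE h) mulrBr.
  by rewrite sumrB -mulr_suml sum_centered// mul0r subr0.
have pP : `|dot y k| <= P * r.
  rewrite dot_sum; apply: le_trans (ler_norm_sum _ _ _) _.
  rewrite /P mulrAC mulr_sumr; apply: ler_sum => j _.
  by rewrite normrM mulrC ler_wpM2r.
have qQ : \sum_j k j 0 ^+ 2 <= Q * r ^+ 2.
  have -> : Q * r ^+ 2 = (2 * r) ^+ 2 * d%:R by rewrite /Q; ring.
  rewrite mulr_natr -[X in _ *+ X]card_ord -sumr_const.
  apply: ler_sum => j _; rewrite -(real_normK (num_real _)).
  by rewrite lerXn2r ?nnegrE ?mulr_ge0.
have sE : \sum_j centered (x + h) j 0 ^+ 2 + eps =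
    s + 2 * dot y k + \sum_j k j 0 ^+ 2.
  have -> : \sum_j centered (x + h) j 0 ^+ 2 =
      \sum_j y j 0 ^+ 2 + 2 * dot y k + \sum_j k j 0 ^+ 2.
    rewrite centeredD dot_sum mulr_sumr -!big_split; apply: eq_bigr => j _ /=.
    by rewrite mxE; ring.
  by rewrite /s; ring.
have s'0 : eps <= s + 2 * dot y k + \sum_j k j 0 ^+ 2.
  by rewrite -sE lerDr sum_sqr_ge0.
have [B1 B2] := inv_sqrt_approx eps0 epss s'0 P0 r0 r1 pP (sum_sqr_ge0 k) qQ.
rewrite !colB !LNE sE.
rewrite ln_jacobianE ln_mxE centeredD colD -/y -/k -/s -yk.
move: B1 B2; set A := Num.sqrt s; set B := Num.sqrt (s + _ + _) => B1 B2.
(* The remainder splits into [k], of order [r], times the first-order increment of the inverse root,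
   and [y] times its second-order remainder. The two halves of the constant, [2 * C1] and [Y * C2],
   bound these. *)
have -> : B^-1 * (g i 0 * (y i 0 + k i 0)) - A^-1 * (g i 0 * y i 0)
   - A^-1 * g i 0 * (k i 0 - y i 0 * dot y k / s)
   = g i 0 * (k i 0 * (B^-1 - A^-1) + y i 0 * (B^-1 - A^-1 + dot y k / A / s)).
  by ring.
rewrite normrM; have -> : G * (2 * C1 + Y * C2) * r ^+ 2 =
    G * ((2 * C1 + Y * C2) * r ^+ 2) by exact: esym (mulrA _ _ _).
apply: (ler_pM (normr_ge0 _) (normr_ge0 _) (le_norm_inf g i)).
apply: le_trans (ler_normD _ _) _; rewrite mulrDl; apply: lerD.
  have -> : 2 * C1 * r ^+ 2 = (2 * r) * (C1 * r) by ring.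
  by rewrite normrM; apply: ler_pM.
have -> : Y * C2 * r ^+ 2 = Y * (C2 * r ^+ 2) by exact: esym (mulrA _ _ _).
by rewrite normrM; exact: (ler_pM (normr_ge0 _) (normr_ge0 _) (le_norm_inf y i) B2).
Qed.

End LayerNorm.

(** * Operator norms of the Jacobian *)

Section ExtremePoints.
Context {R : realType} {d : nat}.

Lemma bigmaxe_attained (I : finType) (i0 : I) (F : I -> R) :
  exists2 i, \big[maxe/-oo%E]_j (F j)%:E = (F i)%:E & forall j, F j <= F i.
Proof.
have [i _ H] := @eq_bigmax _ _ _ -oo%E i0 predT (fun j => (F j)%:E) isT
  (fun j _ => leNye _).
by exists i => // j; rewrite -lee_fin -H; apply: le_bigmax.
Qed.

Lemma norm_inf_signs (b : {ffun 'I_d -> bool}) : (0 < d)%N ->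
  norm_inf (signs b : 'cV[R]_d) = 1.
Proof.
move=> d0; apply/eqP; rewrite eq_le; apply/andP; split.
  by apply/norm_inf_leP => // i; rewrite mxE normrX normrN1 expr1n.
have := le_norm_inf (signs b : 'cV[R]_d) (Ordinal d0).
by rewrite mxE normrX normrN1 expr1n.
Qed.

(* A quasiconvex function increases weakly when some coordinate of its argument
   in [-1, 1] is moved to a suitable endpoint; this is done for one coordinate
   after the other. *)
Lemma quasiconvex_cube_vertex (F : 'cV[R]_d -> R) (u : 'cV[R]_d) :
  (forall (a : R) v w, 0 <= a -> a <= 1 ->
     F (a *: v + (1 - a) *: w) <= Num.max (F v) (F w)) ->
  (forall i, `|u i 0| <= 1) -> exists b, F u <= F (signs b).
Proof.
move=> Fconv u1.
suff H k : (k <= d)%N -> exists b : {ffun 'I_d -> bool},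
    F u <= F (\col_i (if (i < k)%N then (-1) ^+ b i else u i 0)).
  have [b Hb] := H d (leqnn d); exists b; apply: le_trans Hb _.
  rewrite [leLHS](_ : _ = F (signs b))//; congr F.
  by apply/colP => i; rewrite !mxE ltn_ord.
elim: k => [_|k IH kd].
  exists [ffun=> false]; rewrite [leRHS](_ : _ = F u)//; congr F.
  by apply/colP => i; rewrite mxE.
have [b Hb] := IH (ltnW kd); pose k' := Ordinal kd.
pose upd c : {ffun 'I_d -> bool} := [ffun i => if i == k' then c else b i].
pose w c : 'cV[R]_d := \col_i (if (i < k.+1)%N then (-1) ^+ upd c i else u i 0).
have := Fconv ((1 + u k' 0) / 2) (w false) (w true).
have /andP[lo hi] : -1 <= u k' 0 <= 1 by rewrite -ler_norml.
have -> : (1 + u k' 0) / 2 *: w false + (1 - (1 + u k' 0) / 2) *: w true =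
    \col_i (if (i < k)%N then (-1) ^+ b i else u i 0).
  apply/colP => i; rewrite !mxE !ffunE ltnS leq_eqVlt.
  have -> : (i == k :> nat) = (i == k') by [].
  case: eqVneq => [->|ik] /=; first by rewrite ltnn /= expr0 expr1; field.
  by case: ifP => _; field.
have h0 : 0 <= (1 + u k' 0) / 2 by lra.
have h1 : (1 + u k' 0) / 2 <= 1 by lra.
move=> /(_ h0 h1); rewrite le_max => /orP[] /(le_trans Hb) Hw.
  by exists (upd false).
by exists (upd true).
Qed.

End ExtremePoints.

Lemma ln_mx_sym (R : realType) d (y : 'cV[R]_d) s i j :
  ln_mx y s i j = ln_mx y s j i.
Proof. by rewrite !mxE eq_sym [y i 0 * _]mulrC. Qed.

(** * Outputs in the max-norm: rows of the Jacobian *)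

Section LayerNormCondition.
Context {R : realType} {d : nat}.
Variables (g x : 'cV[R]_d) (eps : R).
Hypotheses (d_gt0 : (0 < d)%N) (eps_gt0 : 0 < eps).
Let y := centered x.
Let s := \sum_j y j 0 ^+ 2 + eps.
Let gy := hadamard g y.

Let s_gt0 : 0 < s.
Proof. by rewrite ltr_wpDl ?sum_sqr_ge0. Qed.

(** [t] merges the output scaling with the row factor of the Jacobian. The root of [s] cancels: [t]
    becomes [g] divided by the norm of [gy] for a normwise error, and the inverse of [y], without
    [g], for the componentwise error. *)
Definition out_scaling thout (Nout : 'cV[R]_d -> R) (t : 'cV[R]_d) :=
  exists2 tau, rho_scaled thout (LN g eps x) Nout tau &
    forall i, tau i 0 * ((Num.sqrt s)^-1 * g i 0) = t i 0.

Definition scaled_jacobian (sigma t : 'cV[R]_d) (u : 'cV[R]_d) : 'cV[R]_d :=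
  \col_i (t i 0 * (ln_mx y s *m hadamard sigma u) i 0).

Lemma out_scaling_norm th (N : 'cV[R]_d -> R) : is_norm N ->
  (forall w' w : 'cV[R]_d, rho th w' w = ((N (w' - w))%:E / (N w)%:E)%E) ->
  gy != 0 -> out_scaling th N ((N gy)^-1 *: g).
Proof.
move=> HN rhoE gy0; have [_ N2 _ _] := HN.
have q0 : 0 < (Num.sqrt s)^-1 by rewrite invr_gt0 sqrtr_gt0.
have LNgy : LN g eps x = (Num.sqrt s)^-1 *: gy.
  by apply/colP => i; rewrite LNE !mxE.
have Ngy := is_norm_gt0 HN d_gt0 gy0.
exists (const_mx (N (LN g eps x))^-1).
  apply: (rho_scaled_norm HN (fun w' => rhoE w' _)).
  by rewrite LNgy N2 (gtr0_norm q0) (mulr_gt0 q0 Ngy).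
move=> i; rewrite !mxE LNgy N2 (gtr0_norm q0) invfM mulrACA.
by rewrite mulVf ?mul1r// gt_eqF.
Qed.

Lemma out_scaling_comp : (forall i, g i 0 != 0) -> (forall i, y i 0 != 0) ->
  out_scaling Comp (@norm_inf R d) (\col_i (y i 0)^-1).
Proof.
move=> g0 y0; have q0 : 0 < Num.sqrt s by rewrite sqrtr_gt0.
exists (\col_i (LN g eps x i 0)^-1).
  apply: rho_scaled_comp => i.
  by rewrite LNE mulf_neq0 ?(mulf_neq0 (g0 i))// invr_neq0// gt_eqF.
move=> i; rewrite [X in X * _]mxE [RHS]mxE LNE -/y -/s.
by field; rewrite g0 y0 gt_eqF.
Qed.

Section Bounds.
Variables (thin thout : theta R) (Nin Nout : 'cV[R]_d -> R) (sigma t : 'cV[R]_d).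
Hypotheses (Nin_norm : is_norm Nin) (Nout_norm : is_norm Nout).
Hypotheses (rho_in : rho_param thin x Nin sigma) (rho_out : out_scaling thout Nout t).

Lemma kappa_LN_le (K : R) : 0 <= K ->
  (forall u, Nout (scaled_jacobian sigma t u) <= K * Nin u) ->
  (kappa thin thout (LN g eps) x <= K%:E)%E.
Proof.
move=> K0 H; have [tau Htau tE] := rho_out.
apply: (kappa_le_opnorm d_gt0 d_gt0 Nin_norm Nout_norm rho_in Htau
  (LN_approx g x d_gt0 eps_gt0)) => // u.
apply: le_trans (H u); rewrite le_eqVlt; apply/orP; left; apply/eqP; congr Nout.
apply/colP => i; rewrite [in LHS]mxE ln_jacobianE -/y -/s mulrA tE.
by rewrite [in RHS]mxE.
Qed.

Lemma kappa_LN_ge (K : R) u : 0 < Nin u ->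
  K * Nin u <= Nout (scaled_jacobian sigma t u) ->
  (K%:E <= kappa thin thout (LN g eps) x)%E.
Proof.
move=> u0 H; have [tau Htau tE] := rho_out.
apply: (kappa_ge_opnorm d_gt0 d_gt0 Nin_norm Nout_norm rho_in Htau
  (LN_approx g x d_gt0 eps_gt0)) u0 _.
apply: le_trans H _; rewrite le_eqVlt; apply/orP; left; apply/eqP; congr Nout.
apply/colP => i; rewrite [in RHS]mxE ln_jacobianE -/y -/s mulrA tE.
by rewrite [in LHS]mxE.
Qed.

End Bounds.

(** [rownorm i] plays the dual norm of row [i] after input scaling, given by a bound and a vector
    attaining it. The vector that attains it for the row with the largest weighted norm is extremal
    for the whole Jacobian. *)
Lemma kappa_LN_rows thin thout (Nin : 'cV[R]_d -> R) sigma t (rownorm : 'I_d -> R) :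
  is_norm Nin -> rho_param thin x Nin sigma ->
  out_scaling thout (@norm_inf R d) t ->
  (forall i, 0 <= rownorm i) ->
  (forall i u, `|(ln_mx y s *m hadamard sigma u) i 0| <= rownorm i * Nin u) ->
  (forall i, exists2 u, 0 < Nin u &
     rownorm i * Nin u <= `|(ln_mx y s *m hadamard sigma u) i 0|) ->
  kappa thin thout (LN g eps) x =
    \big[maxe/-oo%E]_i (`|t i 0| * rownorm i)%:E.
Proof.
move=> HN rho_in rho_out r0 rub rlb.
have [i -> Hi] := bigmaxe_attained (Ordinal d_gt0) (fun i => `|t i 0| * rownorm i).
apply/eqP; rewrite eq_le; apply/andP; split.
  apply: (kappa_LN_le HN (norm_inf_is_norm _) rho_in rho_out).
    exact: mulr_ge0.
  move=> u; have u0 := is_norm_ge0 HN d_gt0 u.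
  apply/norm_inf_leP; first by rewrite !mulr_ge0.
  move=> j; rewrite mxE normrM; apply: le_trans (_ : `|t j 0| * (rownorm j * Nin u) <= _).
    exact: ler_wpM2l.
  by rewrite mulrA ler_wpM2r.
have [u u0 Hu] := rlb i.
apply: (kappa_LN_ge HN (norm_inf_is_norm _) rho_in rho_out u0).
apply: le_trans (le_norm_inf _ i); rewrite mxE normrM -mulrA.
exact: ler_wpM2l.
Qed.

Lemma kappa_LN_rows_inf thin thout sigma t :
  rho_param thin x (@norm_inf R d) sigma ->
  out_scaling thout (@norm_inf R d) t ->
  kappa thin thout (LN g eps) x =
    \big[maxe/-oo%E]_i
       (`|t i 0| * \sum_j `|ln_mx y s i j| * `|sigma j 0|)%:E.
Proof.
move=> rho_in rho_out.
apply: (kappa_LN_rows (rownorm := fun i => \sum_j `|ln_mx y s i j| * `|sigma j 0|)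
  (norm_inf_is_norm _) rho_in rho_out).
- by move=> i; apply: sumr_ge0 => j _; apply: mulr_ge0.
- move=> i u; rewrite mxE mulr_suml; apply: le_trans (ler_norm_sum _ _ _) _.
  apply: ler_sum => j _; rewrite [hadamard _ _ _ _]mxE !normrM mulrA.
  by rewrite ler_wpM2l ?mulr_ge0// le_norm_inf.
(* The signs copy those of the scaled row, so that the sum has no cancellation. *)
move=> i; exists (signs [ffun j => ln_mx y s i j * sigma j 0 < 0]).
  by rewrite norm_inf_signs.
rewrite norm_inf_signs// mulr1 mxE; apply: le_trans (ler_norm _).
apply: ler_sum => j _.
have -> : forall b, hadamard sigma (signs b) j 0 = sigma j 0 * (-1) ^+ b j.
  by move=> b; rewrite !mxE.
by rewrite ffunE -normrM mulrA [leRHS]mulrC -normrEsign.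
Qed.

(** With [k] the centred [u] and [p] its product with [y], the image is [k - (p / s) y]. Since the
    squared norm of [y] is [s - eps], the cross term and the last square add up to [- 2 * p ^+ 2 / s
    + p ^+ 2 * (s - eps) / s ^+ 2], that is [- (1 + eps / s) * (p ^+ 2 / s)]. *)
Lemma ln_mx_sqr u : \sum_i (ln_mx y s *m u) i 0 ^+ 2 =
  \sum_i u i 0 ^+ 2 - (\sum_i u i 0) ^+ 2 / d%:R
  - (1 + eps / s) * (dot y u ^+ 2 / s).
Proof.
set p := dot y u; set k := centered u.
have dn0 : d%:R != 0 :> R by rewrite pnatr_eq0 -lt0n.
have pk : \sum_i y i 0 * k i 0 = p.
  rewrite /p dot_sum; under eq_bigr do rewrite (centeredE u) mulrBr.
  by rewrite sumrB -mulr_suml sum_centered// mul0r subr0.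
have kk : \sum_i k i 0 ^+ 2 = \sum_i u i 0 ^+ 2 - (\sum_i u i 0) ^+ 2 / d%:R.
  set S := \sum_i u i 0.
  transitivity (\sum_i (u i 0 ^+ 2 - 2 * d%:R^-1 * S * u i 0 + (d%:R^-1 * S) ^+ 2)).
    by apply: eq_bigr => i _; rewrite /k centeredE -/S; ring.
  rewrite big_split sumrB -mulr_sumr -/S sumr_const card_ord /=.
  by rewrite -[X in _ + X]mulr_natl; field.
transitivity (\sum_i (k i 0 ^+ 2 - 2 * p / s * (y i 0 * k i 0)
                      + (p / s) ^+ 2 * y i 0 ^+ 2)).
  by apply: eq_bigr => i _; rewrite ln_mxE -/p -/k; ring.
rewrite big_split sumrB -!mulr_sumr kk pk /=.
have -> : \sum_i y i 0 ^+ 2 = s - eps by rewrite addrK.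
by field; rewrite dn0 gt_eqF.
Qed.

(** This is [ln_mx_sqr] at a basis vector: by symmetry the column it selects is also the row. *)
Lemma ln_mx_row_sqr i : \sum_j ln_mx y s i j ^+ 2 =
  1 - d%:R^-1 - (1 + eps / s) * (y i 0 ^+ 2 / s).
Proof.
pose e : 'cV[R]_d := \col_j (j == i)%:R.
have eE (F : 'I_d -> R) : \sum_j F j * e j 0 = F i.
  rewrite (bigD1 i)//= mxE eqxx mulr1 big1 ?addr0// => j ji.
  by rewrite mxE (negbTE ji) mulr0.
have := ln_mx_sqr e; rewrite dot_sum eE.
have -> : \sum_j e j 0 = 1.
  by rewrite -(eE (fun=> 1)); apply: eq_bigr => j _; rewrite mul1r.
have -> : \sum_j e j 0 ^+ 2 = 1.
  rewrite -(eE (fun=> 1)); apply: eq_bigr => j _; rewrite mxE.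
  by case: eqP => _; rewrite ?expr1n ?expr0n ?mul1r.
rewrite expr1n mul1r => <-; apply: eq_bigr => j _.
by rewrite [in RHS]mxE eE ln_mx_sym.
Qed.

Lemma kappa_LN_rows_2 thin thout (c : R) t : 0 <= c ->
  rho_param thin x (@norm2 R d) (const_mx c) ->
  out_scaling thout (@norm_inf R d) t ->
  kappa thin thout (LN g eps) x =
    \big[maxe/-oo%E]_i (`|t i 0| * (c * Num.sqrt
       (1 - d%:R^-1 - (1 + eps / s) * (y i 0 ^+ 2 / s))))%:E.
Proof.
move=> c0 rho_in rho_out.
pose a i : 'cV[R]_d := \col_j ln_mx y s i j.
have aE i : norm2 (a i) =
    Num.sqrt (1 - d%:R^-1 - (1 + eps / s) * (y i 0 ^+ 2 / s)).
  rewrite norm2E -ln_mx_row_sqr; congr Num.sqrt.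
  by apply: eq_bigr => j _; rewrite mxE.
have LE i u : (ln_mx y s *m hadamard (const_mx c) u) i 0 = c * dot (a i) u.
  rewrite hadamard_const -scalemxAr mxE; congr (_ * _).
  by rewrite mxE dot_sum; apply: eq_bigr => j _; rewrite [a i j 0]mxE.
apply: (kappa_LN_rows (norm2_is_norm _) rho_in rho_out).
- by move=> i; rewrite mulr_ge0// sqrtr_ge0.
- move=> i u; rewrite LE normrM (ger0_norm c0) -aE -mulrA ler_wpM2l//.
  exact: dot_le_norm2.
(* Equality in Cauchy-Schwarz holds at the row itself. A zero row, as for [d = 1], cannot serve
   since the test vector must have positive norm; any nonzero vector does then. *)
move=> i; rewrite -aE; have [a0|an0] := eqVneq (norm2 (a i)) 0.
  exists (signs [ffun=> false]).
    rewrite lt_def norm2_ge0 andbT; apply/negP => /eqP.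
    move=> /(is_norm_eq0 (norm2_is_norm _))/colP/(_ (Ordinal d_gt0)).
    by rewrite !mxE ffunE expr0 => /eqP; rewrite oner_eq0.
  by rewrite a0 mulr0 mul0r.
exists (a i); first by rewrite lt_def an0 norm2_ge0.
rewrite LE normrM (ger0_norm c0) -norm2_dot normrX (ger0_norm (norm2_ge0 _)).
by rewrite -mulrA expr2.
Qed.

End LayerNormCondition.

Lemma convex_comb_le_max (R : realDomainType) (a v w : R) : 0 <= a -> a <= 1 ->
  a * v + (1 - a) * w <= Num.max v w.
Proof.
move=> a0 a1; have vm : v <= Num.max v w by rewrite le_max lexx.
have wm : w <= Num.max v w by rewrite le_max lexx orbT.
by move: (Num.max v w) vm wm => m vm wm; nra.
Qed.

(** * Outputs in the 2-norm *)

Section Norm2Output.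
Context {R : realType} {d : nat}.
Variables (g x : 'cV[R]_d) (eps : R).
Hypotheses (d_gt0 : (0 < d)%N) (eps_gt0 : 0 < eps).
Let y := centered x.
Let s := \sum_j y j 0 ^+ 2 + eps.
Variable q : R.
Hypotheses (q_gt0 : 0 < q).
Hypothesis rho_out : out_scaling g x eps (Lp 2) (@norm2 R d) (q^-1 *: g).

Lemma norm2_hadamard_le (a w : 'cV[R]_d) :
  norm2 (hadamard a w) <= norm_inf a * norm2 w.
Proof.
rewrite norm2_leP; last by rewrite mulr_ge0 ?norm_inf_ge0 ?norm2_ge0.
rewrite exprMn norm2_sqr mulr_sumr; apply: ler_sum => i _.
rewrite mxE exprMn ler_wpM2r ?sqr_ge0// -(real_normK (num_real _)).
by rewrite lerXn2r ?nnegrE ?norm_inf_ge0// le_norm_inf.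
Qed.

Lemma hadamard_ones c (w : 'cV[R]_d) : hadamard (c *: ones) w = c *: w.
Proof. by apply/colP => i; rewrite !mxE mulr1. Qed.

Lemma norm_inf_ones c : norm_inf (c *: ones : 'cV[R]_d) = `|c|.
Proof.
have [_ N2 _ _] := @norm_inf_is_norm R d; rewrite N2.
have -> : ones = signs [ffun=> false] :> 'cV[R]_d.
  by apply/colP => i; rewrite !mxE ffunE.
by rewrite norm_inf_signs// mulr1.
Qed.

Let Phi sigma u := norm2 (ln_mx y s *m hadamard sigma u).

Let q_norm : `|q^-1| = q^-1.
Proof. by rewrite gtr0_norm// invr_gt0. Qed.

Let scaledE sigma u : scaled_jacobian x eps sigma (q^-1 *: g) u =
  q^-1 *: hadamard g (ln_mx y s *m hadamard sigma u).
Proof.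
apply/colP => i; rewrite [LHS]mxE [RHS]mxE.
by rewrite [X in X * _ = _]mxE [X in _ = _ * X]mxE mulrA.
Qed.

Let scaled_le sigma u :
  norm2 (scaled_jacobian x eps sigma (q^-1 *: g) u) <=
  norm_inf g / q * Phi sigma u.
Proof.
rewrite scaledE norm2Z q_norm [norm_inf g / _]mulrC -[leRHS]mulrA.
by apply: ler_wpM2l (norm2_hadamard_le _ _); rewrite invr_ge0 ltW.
Qed.

Let scaled_eq c sigma u : g = c *: ones ->
  norm2 (scaled_jacobian x eps sigma (q^-1 *: g) u) =
  norm_inf g / q * Phi sigma u.
Proof.
move=> gE; rewrite scaledE norm2Z q_norm [in hadamard _ _]gE.
by rewrite hadamard_ones norm2Z [in norm_inf _]gE norm_inf_ones mulrA [_^-1 * _]mulrC.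
Qed.

(** [K] is the maximum of the convex function [Phi] over the vertices of the cube, hence over the
    cube. The upper bound loses only in replacing the diagonal factor [g] by its largest modulus,
    and nothing is lost there if [g] is constant. *)
Lemma kappa_LN_cube thin sigma (K : R) :
  rho_param thin x (@norm_inf R d) sigma ->
  (exists b, K = Phi sigma (signs b)) -> (forall b, Phi sigma (signs b) <= K) ->
  (kappa thin (Lp 2) (LN g eps) x <= (K * (norm_inf g / q))%:E)%E /\
  (forall c, g = c *: ones ->
     kappa thin (Lp 2) (LN g eps) x = (K * (norm_inf g / q))%:E).
Proof.
move=> rho_in [b KE] Kub.
have G0 : 0 <= norm_inf g / q by rewrite divr_ge0 ?norm_inf_ge0 ?(ltW q_gt0).
have K0 : 0 <= K by rewrite KE norm2_ge0.
have [N1 N2 _ _] := norm2_is_norm (R := R) d.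
have [_ M2 _ _] := norm_inf_is_norm (R := R) d.
have PhiZ a u : Phi sigma (a *: u) = `|a| * Phi sigma u.
  by rewrite /Phi hadamardZ -scalemxAr N2.
have PhiD u v : Phi sigma (u + v) <= Phi sigma u + Phi sigma v.
  by rewrite /Phi hadamardD mulmxDr N1.
have Phiu u : Phi sigma u <= K * norm_inf u.
  have [u0|un0] := eqVneq (norm_inf u) 0.
    rewrite (is_norm_eq0 (norm_inf_is_norm d) u0).
    by rewrite -(scale0r 0) PhiZ M2 normr0 !mul0r mulr0.
  have u0 : 0 < norm_inf u by rewrite lt_def un0 norm_inf_ge0.
  have [|i|b' Hb'] := @quasiconvex_cube_vertex _ _ (Phi sigma) ((norm_inf u)^-1 *: u).
  - move=> a v w a0 a1; apply: le_trans (PhiD _ _) _.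
    rewrite !PhiZ (ger0_norm a0) ger0_norm ?subr_ge0//.
    exact: convex_comb_le_max.
  - rewrite mxE normrM ger0_norm ?invr_ge0 ?norm_inf_ge0// mulrC.
    by rewrite ler_pdivrMr// mul1r le_norm_inf.
  have := le_trans Hb' (Kub b'); rewrite PhiZ ger0_norm ?invr_ge0 ?norm_inf_ge0//.
  by rewrite mulrC ler_pdivrMr.
have ub : (kappa thin (Lp 2) (LN g eps) x <= (K * (norm_inf g / q))%:E)%E.
  apply: (kappa_LN_le d_gt0 eps_gt0 (norm_inf_is_norm _) (norm2_is_norm _) rho_in
    rho_out).
    exact: mulr_ge0.
  move=> u; apply: le_trans (scaled_le _ _) _.
  by rewrite [K * _]mulrC -[leRHS]mulrA; exact: ler_wpM2l.
split=> // c gE; apply/eqP; rewrite eq_le ub /=.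
apply: (kappa_LN_ge d_gt0 eps_gt0 (norm_inf_is_norm _) (norm2_is_norm _) rho_in rho_out
   (u := signs b)); first by rewrite norm_inf_signs.
by rewrite norm_inf_signs// mulr1 (scaled_eq _ _ gE) KE mulrC.
Qed.

(** The contraction property is read off [ln_mx_sqr], whose two subtracted terms are nonnegative. *)
Lemma kappa_LN_22_le :
  (kappa (Lp 2) (Lp 2) (LN g eps) x <= (norm_inf g * norm2 x / q)%:E)%E.
Proof.
have rho_in := @rho_param_norm _ (Lp 2) _ x _ d_gt0 (norm2_is_norm d) (fun _ => erefl).
apply: (kappa_LN_le d_gt0 eps_gt0 (norm2_is_norm _) (norm2_is_norm _) rho_in rho_out).
  by rewrite divr_ge0 ?mulr_ge0 ?norm_inf_ge0 ?norm2_ge0 ?(ltW q_gt0).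
move=> u; apply: le_trans (scaled_le _ _) _.
have E (a b c : R) : a * b / q * c = a / q * (b * c) by ring.
rewrite E.
apply: ler_wpM2l; first by rewrite divr_ge0 ?norm_inf_ge0 ?(ltW q_gt0).
rewrite /Phi hadamard_const -scalemxAr norm2Z (ger0_norm (norm2_ge0 _)).
apply: ler_wpM2l; first exact: norm2_ge0.
rewrite norm2_leP; last exact: norm2_ge0.
rewrite [leRHS]norm2_sqr.
rewrite ln_mx_sqr// -/y -/s -addrA gerDl -opprD oppr_le0.
have s0 : 0 < s by rewrite ltr_wpDl ?sum_sqr_ge0.
apply: addr_ge0; first by rewrite divr_ge0 ?sqr_ge0.
by rewrite mulr_ge0 ?addr_ge0 ?divr_ge0 ?sqr_ge0 ?ltW.
Qed.

(** Three coordinates suffice. The vector is the cross product of the first three entries of [z]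
    with (1, 1, 1), whose last entry is nonzero unless the first two entries of [z] agree; in that
    case the difference of two basis vectors works. *)
Lemma orthogonal_pair_vector (z : 'cV[R]_d) : (2 < d)%N ->
  exists2 u : 'cV[R]_d, u != 0 & \sum_i u i 0 = 0 /\ dot z u = 0.
Proof.
move=> d2; pose i0 := Ordinal (ltnW (ltnW d2)); pose i1 := Ordinal (ltnW d2).
pose i2 := Ordinal d2.
have sumE (F : 'I_d -> R) : (forall i, i != i0 -> i != i1 -> i != i2 -> F i = 0) ->
    \sum_i F i = F i0 + F i1 + F i2.
  move=> H; rewrite (bigD1 i0)//= (bigD1 i1)//= (bigD1 i2)//= big1 ?addr0 ?addrA//.
  by move=> i /andP[/andP[? ?] ?]; exact: H.
pose w (a b c : R) : 'cV[R]_d :=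
  \col_i if i == i0 then a else if i == i1 then b else if i == i2 then c else 0.
have w0 a b c : w a b c i0 0 = a by rewrite mxE eqxx.
have w1 a b c : w a b c i1 0 = b by rewrite mxE eqxx.
have w2 a b c : w a b c i2 0 = c by rewrite mxE eqxx.
have wE a b c i : i != i0 -> i != i1 -> i != i2 -> w a b c i 0 = 0.
  by rewrite mxE => /negbTE -> /negbTE -> /negbTE ->.
have sw a b c : \sum_i w a b c i 0 = a + b + c.
  by rewrite sumE ?w0 ?w1 ?w2// => i *; exact: wE.
have dw a b c : dot z (w a b c) = z i0 0 * a + z i1 0 * b + z i2 0 * c.
  by rewrite dot_sum sumE ?w0 ?w1 ?w2// => i *; rewrite wE ?mulr0.
have [z01|z01] := eqVneq (z i0 0) (z i1 0).
  exists (w 1 (-1) 0); last by rewrite sw dw z01; split; ring.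
  by apply/eqP => /colP/(_ i0)/eqP; rewrite w0 mxE oner_eq0.
exists (w (z i1 0 - z i2 0) (z i2 0 - z i0 0) (z i0 0 - z i1 0)).
  by apply/eqP => /colP/(_ i2)/eqP; rewrite w2 mxE subr_eq0 (negbTE z01).
by rewrite sw dw; split; ring.
Qed.

Lemma kappa_LN_22_eq c : (2 < d)%N -> g = c *: ones ->
  kappa (Lp 2) (Lp 2) (LN g eps) x = (norm_inf g * norm2 x / q)%:E.
Proof.
move=> d2 gE; apply/eqP; rewrite eq_le kappa_LN_22_le /=.
have rho_in := @rho_param_norm _ (Lp 2) _ x _ d_gt0 (norm2_is_norm d) (fun _ => erefl).
have [u un0 [u1 yu]] := orthogonal_pair_vector y d2.
apply: (kappa_LN_ge d_gt0 eps_gt0 (norm2_is_norm _) (norm2_is_norm _) rho_in rho_out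
  (u := u)).
  exact: is_norm_gt0 (norm2_is_norm d) d_gt0 un0.
rewrite (scaled_eq _ _ gE) /Phi hadamard_const -scalemxAr norm2Z.
rewrite (ger0_norm (norm2_ge0 x)).
have -> : norm2 (ln_mx y s *m u) = norm2 u.
  rewrite norm2E ln_mx_sqr// -/y -/s u1 yu norm2E; congr Num.sqrt.
  by rewrite expr0n/= !mul0r mulr0 !subr0.
have E (a b m : R) : a * b / q * m = a / q * (b * m) by ring.
by rewrite E.
Qed.

End Norm2Output.

(** * Constant output and infinite condition numbers *)

Section Degenerate.
Context {R : realType} {d : nat}.
Variables (g x : 'cV[R]_d) (eps : R).
Hypotheses (d_gt0 : (0 < d)%N) (eps_gt0 : 0 < eps).
Variables (thin thout : theta R) (N : 'cV[R]_d -> R) (sigma : 'cV[R]_d).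
Hypotheses (N_norm : is_norm N) (rho_in : rho_param thin x N sigma).

Lemma kappa_LN_const :
  (forall w : 'cV[R]_d, rho thout w w = 0%E) ->
  (forall u, centered (x + hadamard sigma u) = centered x) ->
  kappa thin thout (LN g eps) x = 0%E.
Proof.
move=> rho0 H; apply: (kappa_const (r := 1)) => //.
  have := rho_in.2 0; rewrite hadamard0 addr0 => H0; apply: le_trans H0 _.
  by rewrite (is_norm0 N_norm).
move=> v' /(rho_in.1 _ _)[u -> _].
by rewrite /LN H rho0.
Qed.

(** The step is a multiple of the basis vector of index [j], of norm [t]. As [sigma j 0 != 0], it
    moves coordinate [i] of the centred input from 0 to a nonzero multiple of
    [(i == j)%:R - d%:R^-1], which is nonzero for [1 < d]. The output error is then infinite, and
    its quotient by a finite input error, even by 0, is +oo. *)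
Lemma kappa_LN_pinfty i j : (1 < d)%N -> (forall i, g i 0 != 0) ->
  sigma j 0 != 0 -> centered x i 0 = 0 ->
  (forall w' : 'cV[R]_d, w' i 0 != 0 -> rho thout w' (LN g eps x) = +oo%E) ->
  kappa thin thout (LN g eps) x = +oo%E.
Proof.
move=> d1 g0 sj yi Hout; apply: kappa_pinfty => t t0.
have [_ N2 N3 _] := N_norm.
pose e : 'cV[R]_d := \col_k (k == j)%:R.
have e0 : 0 < N e.
  by apply: lt_le_trans (N3 e j); rewrite mxE eqxx normr1.
pose u := (t / N e) *: e.
have ut : N u = t by rewrite N2 ger0_norm ?divr_ge0 ?ltW// divfK// gt_eqF.
exists (x + hadamard sigma u).
  by have := rho_in.2 u; rewrite ut.
have := rho_in.2 u => /(rho_in.1 _ _)[w _ rhoE].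
rewrite /error_ratio rhoE Hout.
  have w0 : 0 <= N w by apply: is_norm_ge0.
  rewrite inver; case: eqVneq => [_|wn0]; first by rewrite mulyy.
  by rewrite gt0_mulye// lte_fin invr_gt0 lt_def wn0.
rewrite LNE; apply: mulf_neq0.
  rewrite invr_neq0// gt_eqF// sqrtr_gt0.
  by rewrite ltr_wpDl ?sum_sqr_ge0.
apply: mulf_neq0 => //.
have -> : centered (x + hadamard sigma u) i 0 =
    t / N e * sigma j 0 * ((i == j)%:R - d%:R^-1).
  rewrite centeredD [LHS]mxE yi add0r /u hadamardZ centeredZ [LHS]mxE -mulrA.
  congr (_ * _).
  rewrite centeredE.
  have -> : \sum_k hadamard sigma e k 0 = sigma j 0.
    rewrite (bigD1 j)//= !mxE eqxx mulr1 big1 ?addr0// => k kj.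
    by rewrite !mxE (negbTE kj) mulr0.
  by rewrite !mxE mulrBr [_ * d%:R^-1]mulrC; case: eqP => [->|_]; rewrite ?mulr0.
apply: mulf_neq0; first by rewrite mulf_neq0// gt_eqF// divr_gt0.
rewrite subr_eq0.
have d0 : d%:R != 0 :> R by rewrite pnatr_eq0 -lt0n.
case: (i == j); rewrite eq_sym; last by rewrite invr_eq0.
by rewrite invr_eq1 pnatr_eq1 gtn_eqF.
Qed.

End Degenerate.

(** * Degenerate points *)

Lemma ord_le1_eq n (i j : 'I_n) : (n <= 1)%N -> i = j.
Proof.
move=> n1; have ord_eq0 (k : 'I_n) : k = 0%N :> nat.
  by apply/eqP; rewrite -leqn0 -ltnS (leq_trans (ltn_ord k)).
by apply: val_inj; rewrite /= !ord_eq0.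
Qed.

Section ExtendedMax.
Context {R : realType} {I : finType} (i0 : I).
Implicit Types F : I -> R.

Lemma bigmaxe_mulr F (c : R) : 0 <= c ->
  (\big[maxe/-oo]_i (F i)%:E * c%:E = \big[maxe/-oo]_i (F i * c)%:E)%E.
Proof.
move=> c0; have [i -> Fi] := bigmaxe_attained i0 F.
have [j -> Fj] := bigmaxe_attained i0 (fun i => F i * c).
by rewrite -EFinM; congr EFin; apply/eqP; rewrite eq_le Fj ler_wpM2r.
Qed.

Lemma bigmaxe_mul_pinfty F : (exists i, 0 < F i) ->
  (\big[maxe/-oo]_i (F i)%:E * +oo = +oo)%E.
Proof.
move=> [j Fj]; have [i -> Fi] := bigmaxe_attained i0 F.
by rewrite gt0_muley// lte_fin (lt_le_trans Fj).
Qed.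

Lemma bigmaxe_eq0 (F : I -> \bar R) : (forall i, F i = 0%E) ->
  (\big[maxe/-oo]_i F i = 0)%E.
Proof.
move=> F0; have [i H _] := bigmaxe_attained i0 (fun=> 0 : R).
by rewrite -[RHS]H; apply: eq_bigr => j _; rewrite F0.
Qed.

Lemma bigmaxe_pinfty (F : I -> \bar R) : (exists i, F i = +oo%E) ->
  (\big[maxe/-oo]_i F i = +oo)%E.
Proof.
by move=> [i Fi]; apply/eqP; rewrite -leye_eq -Fi; apply: le_bigmax.
Qed.

End ExtendedMax.

Section Scalings.
Context {R : realType} {d : nat}.
Variables (g x : 'cV[R]_d) (eps : R).
Hypotheses (d_gt0 : (0 < d)%N) (eps_gt0 : 0 < eps).
Hypothesis (g_neq0 : forall i, g i 0 != 0).
Let y := centered x.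

Lemma hadamard_neq0 (a w : 'cV[R]_d) : (forall i, a i 0 != 0) -> w != 0 ->
  hadamard a w != 0.
Proof.
move=> a0; apply: contra => /eqP/colP aw0; apply/eqP/colP => i.
have := aw0 i; rewrite [LHS]mxE !mxE => /eqP.
by rewrite mulf_eq0 (negbTE (a0 i)) /= => /eqP.
Qed.

(** By the last two clauses [sigma] vanishes exactly when [x] does. At [x = 0] no point at finite
    distance differs from [x]; otherwise some coordinate can be moved at finite cost. *)
Definition in_scaling thin (N : 'cV[R]_d -> R) sigma :=
  [/\ is_norm N, rho_param thin x N sigma, x = 0 -> sigma = 0
    & x != 0 -> exists j, sigma j 0 != 0].

Definition norm_error th (N : 'cV[R]_d -> R) :=
  is_norm N /\
  forall w' w : 'cV[R]_d, rho th w' w = ((N (w' - w))%:E / (N w)%:E)%E.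

Lemma norm_error_2 : norm_error (Lp 2) (@norm2 R d).
Proof. by split; [exact: norm2_is_norm|]. Qed.

Lemma norm_error_inf : norm_error Linf (@norm_inf R d).
Proof. by split; [exact: norm_inf_is_norm|]. Qed.

Lemma in_scaling_norm th N : norm_error th N -> in_scaling th N (const_mx (N x)).
Proof.
move=> [HN rhoE]; split => //; first exact: (rho_param_norm d_gt0 HN (fun w => rhoE w x)).
  by move=> ->; rewrite is_norm0.
move=> xn0; exists (Ordinal d_gt0); rewrite mxE; apply: contra xn0 => /eqP H.
by rewrite (is_norm_eq0 HN H).
Qed.

Lemma in_scaling_comp : in_scaling Comp (@norm_inf R d) x.
Proof.
split=> //; [exact: norm_inf_is_norm|exact: rho_param_comp|].
move=> xn0; apply/existsP; apply: contraNT xn0 => /existsPn H; apply/eqP/colP => i.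
by rewrite mxE; apply/eqP; have := H i; rewrite negbK.
Qed.

Lemma rho_self_norm th N (w : 'cV[R]_d) : norm_error th N -> rho th w w = 0%E.
Proof. by move=> [HN ->]; rewrite subrr is_norm0// mul0e. Qed.

Lemma rho_self_comp (w : 'cV[R]_d) : rho Comp w w = 0%E.
Proof.
rewrite /rho big1_idem//= ?maxxx// => i _.
by rewrite subrr mul0e abse0.
Qed.

Lemma centered_le1 (z : 'cV[R]_d) : (d <= 1)%N -> centered z = 0.
Proof.
move=> d1; have dE : d = 1%N by apply/eqP; rewrite eqn_leq d1.
apply/colP => i; rewrite centeredE (bigD1 i)//= big1 ?addr0.
  have -> : d%:R = 1 :> R by rewrite dE.
  by rewrite invr1 mul1r subrr mxE.
by move=> j; rewrite (ord_le1_eq j i d1) eqxx.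
Qed.

Lemma kappa_LN_trivial thin thout N sigma : in_scaling thin N sigma ->
  (forall w : 'cV[R]_d, rho thout w w = 0%E) -> x = 0 \/ (d <= 1)%N ->
  kappa thin thout (LN g eps) x = 0%E.
Proof.
move=> [HN rho_in s0 _] rho0 H.
apply: (kappa_LN_const _ _ HN rho_in) => // u.
case: H => [/s0 ->|d1]; last by rewrite !centered_le1.
have -> : hadamard 0 u = 0 by apply/colP => i; rewrite !mxE mul0r.
by rewrite addr0.
Qed.

Lemma kappa_LN_pinfty_norm thin thout N N' sigma : in_scaling thin N sigma ->
  norm_error thout N' -> (1 < d)%N -> x != 0 -> y = 0 ->
  kappa thin thout (LN g eps) x = +oo%E.
Proof.
move=> [HN rho_in _ sn0] [HN' rhoE] d1 /sn0[j sj] y0.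
have LN0 : LN g eps x = 0 by apply/colP => i; rewrite LNE -/y y0 !mxE !mulr0.
apply: (kappa_LN_pinfty d_gt0 eps_gt0 HN rho_in (i := Ordinal d_gt0) d1 g_neq0 sj).
  by rewrite -/y y0 mxE.
move=> w' w'0; rewrite rhoE LN0 subr0 (is_norm0 HN') inve0 gt0_muley// lte_fin.
rewrite lt_def is_norm_ge0// andbT; apply: contra w'0 => /eqP H.
by rewrite (is_norm_eq0 HN' H) mxE.
Qed.

Lemma kappa_LN_pinfty_comp thin N sigma i : in_scaling thin N sigma ->
  (1 < d)%N -> x != 0 -> y i 0 = 0 ->
  kappa thin Comp (LN g eps) x = +oo%E.
Proof.
move=> [HN rho_in _ sn0] d1 /sn0[j sj] yi0.
apply: (kappa_LN_pinfty d_gt0 eps_gt0 HN rho_in (i := i) d1 g_neq0 sj yi0).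
move=> w' w'0; apply/eqP; rewrite -leye_eq; apply: (bigmax_sup i) => //.
rewrite LNE -/y yi0 !mulr0 subr0 inve0 abseM.
by rewrite (_ : `|+oo%E|%E = +oo%E)// gt0_muley// lte_fin normr_gt0.
Qed.

End Scalings.

(** * The nine condition numbers *)

Section Formulas.
Context {R : realType} {d : nat}.
Variables (g x : 'cV[R]_d) (eps : R).
Hypotheses (d_gt0 : (0 < d)%N) (eps_gt0 : 0 < eps).
Hypothesis (g_neq0 : forall i, g i 0 != 0).
Let f : 'cV[R]_d -> 'cV[R]_d := LN g eps.
Let y : 'cV[R]_d := centered x.
Let s : R := \sum_j y j 0 ^+ 2 + eps.
Let gy : 'cV[R]_d := hadamard g y.
Let i0 := Ordinal d_gt0.

Let s_gt0 : 0 < s.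
Proof. by rewrite ltr_wpDl ?sum_sqr_ge0. Qed.

Let d_neq0 : d%:R != 0 :> R.
Proof. by rewrite pnatr_eq0 -lt0n. Qed.

(** The squared norm of a row is nonnegative and equals the diagonal entry minus a nonnegative term.
    Hence the diagonal entries appear in the formulas without absolute value. *)
Lemma ln_mx_diag_ge0 i : 0 <= 1 - d%:R^-1 - y i 0 ^+ 2 / s.
Proof.
have : 0 <= \sum_j ln_mx y s i j ^+ 2 by apply: sumr_ge0 => j _; exact: sqr_ge0.
rewrite ln_mx_row_sqr// -/y -/s.
have : 0 <= eps / s * (y i 0 ^+ 2 / s).
  by apply: mulr_ge0; rewrite divr_ge0 ?sqr_ge0// ltW.
by set b := y i 0 ^+ 2 / s; set a := eps / s; nra.
Qed.

Lemma sum_abs_ln_mx (w : 'I_d -> R) i :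
  \sum_j `|ln_mx y s i j| * w j =
  (1 - d%:R^-1 - y i 0 ^+ 2 / s) * w i
  + \sum_(j < d | j != i) `|d%:R^-1 + y i 0 * y j 0 / s| * w j.
Proof.
have lnE j : ln_mx y s i j = (i == j)%:R - d%:R^-1 - y i 0 * y j 0 / s.
  by rewrite [LHS]mxE.
rewrite (bigD1 i)//= lnE eqxx -[y i 0 * y i 0]expr2 ger0_norm ?ln_mx_diag_ge0//.
congr (_ + _); apply: eq_bigr => j ji; rewrite lnE eq_sym (negbTE ji).
by rewrite sub0r -opprD normrN.
Qed.

Let gy0E : y = 0 -> gy = 0.
Proof. by move=> y0; apply/colP => i; rewrite [LHS]mxE y0 !mxE mulr0. Qed.

(** The case analysis shared by all max-norm outputs. The conditions for [x = 0] and [d <= 1] make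
    the right side 0, the one for [y = 0] makes it +oo, and the last one covers the regular points,
    where [c] is moved out of the maximum. *)
Lemma kappa_Linf_formula thin N sigma (row : 'I_d -> R) (c : R) :
  in_scaling x thin N sigma -> 0 <= c ->
  (x = 0 -> (forall i, row i = 0) \/ c = 0) ->
  ((d <= 1)%N -> forall i, row i = 0) ->
  ((1 < d)%N -> x != 0 -> y = 0 -> 0 < c /\ exists i, 0 < row i) ->
  (forall t, out_scaling g x eps Linf (@norm_inf R d) t ->
     kappa thin Linf f x = (\big[maxe/-oo]_i (`|t i 0| * (row i * c))%:E)%E) ->
  kappa thin Linf f x =
    (\big[maxe/-oo]_(i < d) (`|g i 0| * row i)%:E
      * (c%:E / (norm_inf gy)%:E))%E.
Proof.
move=> Hin c0 Hx Hd Hinf Hfin.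
have triv : x = 0 \/ (d <= 1)%N -> kappa thin Linf f x = 0%E.
  move=> H; apply: (kappa_LN_trivial g eps d_gt0 Hin _ H) => w.
  exact: rho_self_norm norm_error_inf.
have big0 : (forall i, row i = 0) ->
    (\big[maxe/-oo]_(i < d) (`|g i 0| * row i)%:E = 0)%E.
  by move=> H; apply: (bigmaxe_eq0 i0) => i; rewrite H mulr0.
have [x0|xn0] := eqVneq x 0.
  rewrite triv; last by left.
  (* The denominator is 0 here: a zero maximum wins by [0 * +oo = 0], a zero [c] by 0/0 = 0. *)
  by case: (Hx x0) => [/big0 ->|->]; rewrite !mul0e ?mule0.
have [d1|d1] := leqP d 1%N.
  by rewrite triv; [rewrite big0 ?mul0e//; exact: Hd|right].
have [y0|yn0] := eqVneq y 0.
  rewrite (kappa_LN_pinfty_norm d_gt0 eps_gt0 g_neq0 Hin norm_error_inf d1 xn0 y0).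
  have [cp [i ri]] := Hinf d1 xn0 y0.
  rewrite gy0E// (is_norm0 (norm_inf_is_norm d)) inve0 gt0_muley ?lte_fin//.
  rewrite (bigmaxe_mul_pinfty i0)//.
  by exists i; rewrite mulr_gt0// normr_gt0.
have gyn0 : gy != 0 := hadamard_neq0 g_neq0 yn0.
have n0 := is_norm_gt0 (norm_inf_is_norm d) d_gt0 gyn0.
have Hout := out_scaling_norm (th := Linf) d_gt0 eps_gt0 (norm_inf_is_norm d)
  (fun _ _ => erefl) gyn0.
rewrite (Hfin _ Hout).
rewrite inver gt_eqF// -EFinM (bigmaxe_mulr i0); last by rewrite divr_ge0// ltW.
apply: eq_bigr => i _; congr EFin; rewrite mxE normrM gtr0_norm ?invr_gt0//.
by move: (norm_inf gy)^-1 => q; ring.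
Qed.

(** The counterpart for the 2-norm, with sign vectors instead of rows. The last hypothesis fixes
    only the product of [F b] and [c], so the size of [x] may sit in either factor: in [c] for a
    normwise input error, in [F] for a componentwise one. *)
Lemma kappa_L2_formula thin sigma (F : {ffun 'I_d -> bool} -> R) (c : R) :
  in_scaling x thin (@norm_inf R d) sigma -> 0 <= c ->
  (forall b, 0 <= F b) ->
  (x = 0 -> (forall b, F b = 0) \/ c = 0) ->
  ((d <= 1)%N -> forall b, F b = 0) ->
  ((1 < d)%N -> x != 0 -> y = 0 -> 0 < c /\ exists b, 0 < F b) ->
  (forall b, norm2 (ln_mx y s *m hadamard sigma (signs b)) * norm_inf g = F b * c) ->
  let B := (\big[maxe/-oo]_(b : {ffun 'I_d -> bool}) (F b)%:E
             * (c%:E / (norm2 gy)%:E))%E in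
  (kappa thin (Lp 2) f x <= B)%E /\
  (forall a, g = a *: ones -> kappa thin (Lp 2) f x = B).
Proof.
move=> Hin c0 F0 Hx Hd Hinf Hfin B.
have b0 : {ffun 'I_d -> bool} := [ffun=> false].
have triv : x = 0 \/ (d <= 1)%N -> kappa thin (Lp 2) f x = 0%E.
  move=> H; apply: (kappa_LN_trivial g eps d_gt0 Hin _ H) => w.
  exact: rho_self_norm norm_error_2.
have big0 : (forall b, F b = 0) ->
    (\big[maxe/-oo]_(b : {ffun 'I_d -> bool}) (F b)%:E = 0)%E.
  by move=> H; apply: (bigmaxe_eq0 b0) => b; rewrite H.
(* At the degenerate points equality holds for every [g]; only [y != 0] leaves an inequality. *)
suff : kappa thin (Lp 2) f x = B \/ (y != 0 /\
   ((kappa thin (Lp 2) f x <= B)%E /\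
  (forall a, g = a *: ones -> kappa thin (Lp 2) f x = B))).
  by case=> [->|[_ //]]; split.
rewrite /B; have [x0|xn0] := eqVneq x 0.
  left; rewrite triv; last by left.
  by case: (Hx x0) => [/big0 ->|->]; rewrite !mul0e ?mule0.
have [d1|d1] := leqP d 1%N.
  by left; rewrite triv; [rewrite big0 ?mul0e//; exact: Hd|right].
have [y0|yn0] := eqVneq y 0.
  left.
  rewrite (kappa_LN_pinfty_norm d_gt0 eps_gt0 g_neq0 Hin norm_error_2 d1 xn0 y0).
  have [cp Fp] := Hinf d1 xn0 y0.
  rewrite gy0E// (is_norm0 (norm2_is_norm d)) inve0 gt0_muley ?lte_fin//.
  by rewrite (bigmaxe_mul_pinfty b0).
right; split=> //; have gyn0 : gy != 0 := hadamard_neq0 g_neq0 yn0.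
have n0 := is_norm_gt0 (norm2_is_norm d) d_gt0 gyn0.
have Hout := out_scaling_norm (th := Lp 2) d_gt0 eps_gt0 (norm2_is_norm d)
  (fun _ _ => erefl) gyn0.
have g0 : 0 < norm_inf g.
  by apply: lt_le_trans (le_norm_inf g i0); rewrite normr_gt0.
have [b -> Fb] := bigmaxe_attained b0 F.
have [_ rho_in _ _] := Hin.
have [] := kappa_LN_cube d_gt0 eps_gt0 n0 Hout rho_in
  (K := norm2 (ln_mx y s *m hadamard sigma (signs b))).
- exact: ex_intro _ b (erefl _).
- have mono (p q u w G : R) : 0 < G -> p * G = u * c -> q * G = w * c -> u <= w ->
      p <= q.
    by move=> G0 pG qG uw; rewrite -(ler_pM2r G0) pG qG ler_wpM2r.
  by move=> b'; exact: mono g0 (Hfin b') (Hfin b) (Fb b').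
have -> : (norm2 (ln_mx y s *m hadamard sigma (signs b)) *
    (norm_inf g / norm2 gy))%:E = ((F b)%:E * (c%:E / (norm2 gy)%:E))%E.
  by rewrite mulrA (Hfin b) -mulrA inver gt_eqF.
by split.
Qed.

End Formulas.

(** * Formulas for normwise output errors *)

Section ConditionNumbers.
Context {R : realType} {d : nat}.
Variables (g x : 'cV[R]_d) (eps : R).
Hypotheses (d_gt0 : (0 < d)%N) (eps_gt0 : 0 < eps).
Hypothesis (g_neq0 : forall i, g i 0 != 0).
Let f : 'cV[R]_d -> 'cV[R]_d := LN g eps.
Let y : 'cV[R]_d := centered x.
Let s : R := \sum_j y j 0 ^+ 2 + eps.
Let gy : 'cV[R]_d := hadamard g y.
Let i0 := Ordinal d_gt0.

Let s_gt0 : 0 < s.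
Proof. by rewrite ltr_wpDl ?sum_sqr_ge0. Qed.

Let d_neq0 : d%:R != 0 :> R.
Proof. by rewrite pnatr_eq0 -lt0n. Qed.

Let dinv1 : (d <= 1)%N -> d%:R^-1 = 1 :> R.
Proof.
move=> d1; have -> : d = 1%N by apply/eqP; rewrite eqn_leq d1.
by rewrite invr1.
Qed.

Let dinv_lt1 : (1 < d)%N -> 0 < 1 - d%:R^-1 :> R.
Proof. by move=> d1; rewrite subr_gt0 invf_lt1 ?ltr1n// ltr0n. Qed.

Let y_eq0 : (d <= 1)%N -> forall i, y i 0 = 0.
Proof. by move=> d1 i; rewrite /y centered_le1// mxE. Qed.

Let no_other : (d <= 1)%N -> forall i (F : 'I_d -> R),
  \sum_(j < d | j != i) F j = 0.
Proof.
move=> d1 i F; apply: big1 => j.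
by rewrite (ord_le1_eq j i d1) eqxx.
Qed.

Let x_coord : x != 0 -> exists i, 0 < `|x i 0|.
Proof.
move=> xn0; have [_ _ _ /(_ xn0)[i xi]] := in_scaling_comp x.
by exists i; rewrite normr_gt0.
Qed.

Lemma kappa_LN_2_inf :
  kappa (Lp 2) Linf f x =
    (\big[maxe/-oo]_(i < d)
       (`|g i 0| * Num.sqrt (1 - d%:R^-1 - (1 + eps / s) * (y i 0 ^+ 2 / s)))%:E
     * ((norm2 x)%:E / (norm_inf gy)%:E))%E.
Proof.
have Hin := in_scaling_norm x d_gt0 norm_error_2.
have [_ rho_in _ _] := Hin.
apply: (kappa_Linf_formula d_gt0 eps_gt0 g_neq0 Hin) => //.
- exact: norm2_ge0.
- by move=> x0; right; rewrite x0 (is_norm0 (norm2_is_norm d)).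
- move=> d1 i; rewrite -/y y_eq0// dinv1// subrr expr0n/= mul0r mulr0 subr0.
  exact: sqrtr0.
- move=> d1 xn0 y0; split; first exact: is_norm_gt0 (norm2_is_norm d) _ _.
  exists i0; rewrite /y y0 mxE expr0n/= mul0r mulr0 subr0 sqrtr_gt0.
  exact: dinv_lt1.
move=> t Hout; rewrite (kappa_LN_rows_2 d_gt0 eps_gt0 (norm2_ge0 x) rho_in Hout).
by apply: eq_bigr => i _; congr (_ * _)%:E; rewrite mulrC.
Qed.

Lemma kappa_LN_inf_inf :
  kappa Linf Linf f x =
    (\big[maxe/-oo]_(i < d)
       (`|g i 0| * (1 - d%:R^-1 - y i 0 ^+ 2 / s
          + \sum_(j < d | j != i) `|d%:R^-1 + y i 0 * y j 0 / s|))%:E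
     * ((norm_inf x)%:E / (norm_inf gy)%:E))%E.
Proof.
have Hin := in_scaling_norm x d_gt0 norm_error_inf.
have [_ rho_in _ _] := Hin.
apply: (kappa_Linf_formula d_gt0 eps_gt0 g_neq0 Hin) => //.
- exact: norm_inf_ge0.
- by move=> x0; right; rewrite x0 (is_norm0 (norm_inf_is_norm d)).
- move=> d1 i; rewrite no_other// -/y y_eq0// dinv1// subrr expr0n/= mul0r.
  by rewrite subr0 addr0.
- move=> d1 xn0 y0; split; first exact: is_norm_gt0 (norm_inf_is_norm d) _ _.
  exists i0; rewrite ltr_wpDr ?sumr_ge0//.
  by rewrite /y y0 mxE expr0n/= mul0r subr0 dinv_lt1.
move=> t Hout; rewrite (kappa_LN_rows_inf d_gt0 eps_gt0 rho_in Hout).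
apply: eq_bigr => i _; congr (_ * _)%:E; rewrite -/y -/s.
transitivity ((\sum_j `|ln_mx y s i j| * 1) * norm_inf x).
  rewrite mulr_suml; apply: eq_bigr => j _; rewrite mulr1 [const_mx _ _ _]mxE.
  by congr (_ * _); rewrite ger0_norm// norm_inf_ge0.
rewrite sum_abs_ln_mx// mulr1; congr ((_ + _) * _).
by apply: eq_bigr => j _; rewrite mulr1.
Qed.

Lemma kappa_LN_comp_inf :
  kappa Comp Linf f x =
    (\big[maxe/-oo]_(i < d)
       (`|g i 0| * ((1 - d%:R^-1 - y i 0 ^+ 2 / s) * `|x i 0|
          + \sum_(j < d | j != i)
              `|d%:R^-1 + y i 0 * y j 0 / s| * `|x j 0|))%:E
     * (1 / (norm_inf gy)%:E))%E.
Proof.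
have Hin := in_scaling_comp x; have [_ rho_in _ _] := Hin.
apply: (kappa_Linf_formula d_gt0 eps_gt0 g_neq0 Hin) => //.
- move=> x0; left=> i; rewrite big1 ?addr0.
    by rewrite [X in `|X|](_ : _ = 0) ?normr0 ?mulr0// x0 mxE.
  by move=> j _; rewrite [X in _ * `|X|](_ : _ = 0) ?normr0 ?mulr0// x0 mxE.
- move=> d1 i; rewrite no_other// -/y y_eq0// dinv1// subrr expr0n/= mul0r.
  by rewrite subr0 mul0r addr0.
- move=> d1 xn0 y0; split=> //; have [i xi] := x_coord xn0; exists i.
  apply: ltr_wpDr; first by apply: sumr_ge0 => j _; rewrite mulr_ge0.
  by rewrite /y y0 mxE expr0n/= mul0r subr0 mulr_gt0// dinv_lt1.
move=> t Hout; rewrite (kappa_LN_rows_inf d_gt0 eps_gt0 rho_in Hout).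
apply: eq_bigr => i _; congr (_ * _)%:E; rewrite mulr1 -/y -/s.
exact: sum_abs_ln_mx.
Qed.

(** For [1 < d] this sign vector is not constant. At [y = 0] the matrix A is the centring
    projection, and the bound is +oo, rather than 0, only if some sign vector, scaled by the input,
    is not annihilated by it. *)
Let flip : {ffun 'I_d -> bool} := [ffun i => i == i0].

Let centered_flip (z : 'cV[R]_d) : (1 < d)%N ->
  (forall i j, z i 0 = z j 0) -> z != 0 -> centered (hadamard z (signs flip)) != 0.
Proof.
move=> d1 zc zn0; pose i1 := Ordinal d1.
have z0 : z i0 0 != 0.
  apply: contra zn0 => /eqP z0; apply/eqP/colP => i.
  by rewrite (zc i i0) z0 mxE.
apply/eqP => /colP H; have := H i0; have := H i1.
rewrite !centeredE !mxE !ffunE /= (zc i1 i0).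
set m := _ * \sum_j _; rewrite expr0 expr1 => h1 h0.
by have /eqP := z0; apply; lra.
Qed.

Let ln_mx_norm (u : 'cV[R]_d) : norm2 (ln_mx y s *m u) =
  Num.sqrt (\sum_i u i 0 ^+ 2 - (\sum_i u i 0) ^+ 2 / d%:R
    - (1 + eps / s) * (dot y u ^+ 2 / s)).
Proof. by rewrite norm2E ln_mx_sqr. Qed.

Let ln_mx_le1 (u : 'cV[R]_d) : (d <= 1)%N -> ln_mx y s *m u = 0.
Proof.
move=> d1; apply/colP => i; rewrite ln_mxE (y_eq0 d1 i) 2!mul0r subr0.
by rewrite centered_le1// !mxE.
Qed.

Let ln_mx_y0 (u : 'cV[R]_d) : y = 0 -> ln_mx y s *m u = centered u.
Proof. move=> y0; apply/colP => i; rewrite ln_mxE.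
have -> : y i 0 = 0 by rewrite y0 mxE.
by rewrite 2!mul0r subr0. Qed.

Let signs_sqr (b : {ffun 'I_d -> bool}) i : (signs b : 'cV[R]_d) i 0 ^+ 2 = 1.
Proof. by rewrite mxE sqrr_sign. Qed.

Lemma kappa_LN_inf_2 :
  let B := (\big[maxe/-oo]_(b : {ffun 'I_d -> bool})
       (Num.sqrt (d%:R - dot (signs b) ones ^+ 2 / d%:R
          - (1 + eps / s) * (dot (signs b) y ^+ 2 / s)))%:E
     * ((norm_inf g * norm_inf x)%:E / (norm2 gy)%:E))%E in
  (kappa Linf (Lp 2) f x <= B)%E /\
  (forall c, g = c *: ones -> kappa Linf (Lp 2) f x = B).
Proof.
have Hin := in_scaling_norm x d_gt0 norm_error_inf.
have FE (b : {ffun 'I_d -> bool}) : Num.sqrt (d%:R - dot (signs b) ones ^+ 2 / d%:R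
    - (1 + eps / s) * (dot (signs b) y ^+ 2 / s)) = norm2 (ln_mx y s *m signs b).
  rewrite ln_mx_norm (dotC y); congr (Num.sqrt (_ - _ ^+ 2 / _ - _)).
    by under eq_bigr do rewrite signs_sqr; rewrite sumr_const card_ord.
  by rewrite dot_sum; apply: eq_bigr => i _; rewrite [ones _ _]mxE mulr1.
have g0 : 0 < norm_inf g.
  by apply: lt_le_trans (le_norm_inf g i0); rewrite normr_gt0.
apply: (kappa_L2_formula d_gt0 eps_gt0 g_neq0 Hin).
- by rewrite mulr_ge0 ?norm_inf_ge0.
- by move=> b; exact: sqrtr_ge0.
- by move=> x0; right; rewrite x0 (is_norm0 (norm_inf_is_norm d)) mulr0.
- by move=> d1 b; rewrite FE ln_mx_le1// (is_norm0 (norm2_is_norm d)).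
- move=> d1 xn0 y0; split.
    by rewrite mulr_gt0// (is_norm_gt0 (norm_inf_is_norm d)).
  exists flip; rewrite FE ln_mx_y0// (is_norm_gt0 (norm2_is_norm d))//.
  have -> : signs flip = hadamard ones (signs flip) :> 'cV[R]_d.
    by apply/colP => i; rewrite !mxE mul1r.
  apply: centered_flip => //; first by move=> i j; rewrite !mxE.
  by apply/eqP => /colP/(_ i0)/eqP; rewrite !mxE oner_eq0.
move=> b; rewrite FE hadamard_const -scalemxAr norm2Z (ger0_norm (norm_inf_ge0 _)).
have E (p q r : R) : p * q * r = q * (r * p) by ring.
exact: E.
Qed.

Lemma kappa_LN_comp_2 :
  let B := (\big[maxe/-oo]_(b : {ffun 'I_d -> bool})
       (Num.sqrt (\sum_i x i 0 ^+ 2 - dot (signs b) x ^+ 2 / d%:R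
          - (1 + eps / s) * (dot (signs b) (hadamard y x) ^+ 2 / s)))%:E
     * ((norm_inf g)%:E / (norm2 gy)%:E))%E in
  (kappa Comp (Lp 2) f x <= B)%E /\
  (forall c, g = c *: ones -> kappa Comp (Lp 2) f x = B).
Proof.
have Hin := in_scaling_comp x.
have FE (b : {ffun 'I_d -> bool}) :
  Num.sqrt (\sum_i x i 0 ^+ 2 - dot (signs b) x ^+ 2 / d%:R
    - (1 + eps / s) * (dot (signs b) (hadamard y x) ^+ 2 / s)) =
    norm2 (ln_mx y s *m hadamard x (signs b)).
  rewrite ln_mx_norm; congr (Num.sqrt (_ - _ ^+ 2 / _ - _ * (_ ^+ 2 / _))).
  - by apply: eq_bigr => i _; rewrite [hadamard _ _ _ _]mxE exprMn signs_sqr mulr1.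
  - by rewrite dot_sum; apply: eq_bigr => i _; rewrite [hadamard _ _ _ _]mxE mulrC.
  - rewrite !dot_sum; apply: eq_bigr => i _.
    by rewrite ![hadamard _ _ _ _]mxE mulrC mulrA.
have g0 : 0 < norm_inf g.
  by apply: lt_le_trans (le_norm_inf g i0); rewrite normr_gt0.
apply: (kappa_L2_formula d_gt0 eps_gt0 g_neq0 Hin).
- exact: norm_inf_ge0.
- by move=> b; exact: sqrtr_ge0.
- move=> x0; left => b; rewrite FE.
  have -> : hadamard x (signs b) = 0 by apply/colP => i; rewrite x0 !mxE mul0r.
  by rewrite mulmx0 (is_norm0 (norm2_is_norm d)).
- by move=> d1 b; rewrite FE ln_mx_le1// (is_norm0 (norm2_is_norm d)).
- move=> d1 xn0 y0; split=> //.
  exists flip; rewrite FE ln_mx_y0// (is_norm_gt0 (norm2_is_norm d))//.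
  apply: centered_flip => // i j.
  (* At [y = 0] all entries of [x] equal its mean, so the scaled sign vector is again two-valued. *)
  have yE k : x k 0 = d%:R^-1 * \sum_j x j 0.
    by apply/eqP; rewrite -subr_eq0 -centeredE y0 mxE.
  by rewrite !yE.
by move=> b; rewrite FE.
Qed.

(** Three sources of equality match the three alternatives: a vector fixed by A for [2 < d],
    infinite values on both sides when [y = 0] and [x != 0], and zero on both sides when [x = 0]. *)
Lemma kappa_LN_2_2 : let B := ((norm_inf g * norm2 x)%:E / (norm2 gy)%:E)%E in
  (kappa (Lp 2) (Lp 2) f x <= B)%E /\
  (forall c, g = c *: ones -> (2 < d)%N \/ (d = 2%N /\ y = 0) \/ x = 0 ->
     kappa (Lp 2) (Lp 2) f x = B).
Proof.
move=> B; have Hin := in_scaling_norm x d_gt0 norm_error_2.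
have g0 : 0 < norm_inf g.
  by apply: lt_le_trans (le_norm_inf g i0); rewrite normr_gt0.
have triv : x = 0 \/ (d <= 1)%N -> kappa (Lp 2) (Lp 2) f x = 0%E.
  move=> H; apply: (kappa_LN_trivial g eps d_gt0 Hin _ H) => w.
  exact: rho_self_norm norm_error_2.
have [x0|xn0] := eqVneq x 0.
  rewrite triv; last by left.
  by rewrite /B x0 (is_norm0 (norm2_is_norm d)) mulr0 mul0e; split.
have x_gt0 := is_norm_gt0 (norm2_is_norm d) d_gt0 xn0.
have [y0|yn0] := eqVneq y 0.
  have -> : B = +oo%E.
    have gy0 : gy = 0 by apply/colP => i; rewrite [LHS]mxE y0 !mxE mulr0.
    rewrite /B gy0 (is_norm0 (norm2_is_norm d)) inve0 gt0_muley// lte_fin.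
    exact: mulr_gt0.
  split=> [|c _ H]; first exact: leey.
  have d1 : (1 < d)%N.
    case: H => [/ltnW//|[[d2 _]|x0]]; last by rewrite x0 eqxx in xn0.
    by rewrite d2.
  exact: (kappa_LN_pinfty_norm d_gt0 eps_gt0 g_neq0 Hin norm_error_2 d1 xn0 y0).
have gyn0 : gy != 0 := hadamard_neq0 g_neq0 yn0.
have n0 := is_norm_gt0 (norm2_is_norm d) d_gt0 gyn0.
have Hout := out_scaling_norm (th := Lp 2) d_gt0 eps_gt0 (norm2_is_norm d)
  (fun _ _ => erefl) gyn0.
have BE : B = (norm_inf g * norm2 x / norm2 gy)%:E by rewrite /B inver gt_eqF.
rewrite BE; split; first exact: kappa_LN_22_le.
move=> c gE [d2|[[_ y0]|x0]].
- exact: (kappa_LN_22_eq d_gt0 eps_gt0 n0 Hout d2 gE).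
- by rewrite y0 eqxx in yn0.
- by rewrite x0 eqxx in xn0.
Qed.

End ConditionNumbers.

(** * Formulas for componentwise output errors *)

Section ComponentwiseOutput.
Context {R : realType} {d : nat}.
Variables (g x : 'cV[R]_d) (eps : R).
Hypotheses (d_gt0 : (0 < d)%N) (eps_gt0 : 0 < eps).
Hypothesis (g_neq0 : forall i, g i 0 != 0).
Let f : 'cV[R]_d -> 'cV[R]_d := LN g eps.
Let y : 'cV[R]_d := centered x.
Let s : R := \sum_j y j 0 ^+ 2 + eps.
Let i0 := Ordinal d_gt0.

Let s_gt0 : 0 < s.
Proof. by rewrite ltr_wpDl ?sum_sqr_ge0. Qed.

Let d_neq0 : d%:R != 0 :> R.
Proof. by rewrite pnatr_eq0 -lt0n. Qed.

Let y_le1 : (d <= 1)%N -> forall i, y i 0 = 0.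
Proof. by move=> d1 i; rewrite /y centered_le1// mxE. Qed.

Let dB1_eq0 : (d <= 1)%N -> d%:R - 1 = 0 :> R.
Proof.
move=> d1; have -> : d = 1%N by apply/eqP; rewrite eqn_leq d1.
by rewrite subrr.
Qed.

Let no_other : (d <= 1)%N -> forall i (F : 'I_d -> \bar R),
  (\sum_(j < d | j != i) F j = 0)%E.
Proof.
move=> d1 i F; apply: big1 => j.
by rewrite (ord_le1_eq j i d1) eqxx.
Qed.

(** At [y i 0 = 0] the first quotient is +oo for [1 < d], but 0/0 = 0 for [d = 1]; this is exactly
    the behaviour of the condition number. *)
Let diag (i : 'I_d) : \bar R :=
  ((d%:R - 1)%:E / (d%:R * `|y i 0|)%:E - (`|y i 0| / s)%:E)%E.

Let offdiag (i j : 'I_d) : \bar R :=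
  (`|1 / (d%:R * y i 0)%:E + (y j 0 / s)%:E|)%E.

Let diag_fin i : y i 0 != 0 ->
  diag i = (`|y i 0|^-1 * (1 - d%:R^-1 - y i 0 ^+ 2 / s))%:E.
Proof.
move=> yi; have ayi : `|y i 0| != 0 by rewrite normr_eq0.
rewrite /diag inver mulf_eq0 (negbTE d_neq0) (negbTE ayi)/=.
rewrite -EFinM -EFinB -[in RHS](real_normK (num_real (y i 0))).
move: ayi; move: `|y i 0| => a a0; congr EFin.
by field; rewrite d_neq0 a0 gt_eqF.
Qed.

Let offdiag_fin i j : y i 0 != 0 ->
  offdiag i j = (`|y i 0|^-1 * `|d%:R^-1 + y i 0 * y j 0 / s|)%:E.
Proof.
move=> yi; rewrite /offdiag inver mulf_eq0 (negbTE d_neq0) (negbTE yi)/=.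
rewrite -normfV -normrM; congr (`|_|%:E).
move: (y i 0) (y j 0) yi => a b a0.
by field; rewrite d_neq0 a0 gt_eqF.
Qed.

Let diag_pinfty i : (1 < d)%N -> y i 0 = 0 -> diag i = +oo%E.
Proof.
move=> d1 yi; rewrite /diag yi normr0 mulr0 mul0r inve0 gt0_muley ?sube0//.
by rewrite lte_fin subr_gt0 ltr1n.
Qed.

Let offdiag_pinfty i j : y i 0 = 0 -> offdiag i j = +oo%E.
Proof. by move=> yi; rewrite /offdiag yi mulr0 inve0 mul1e. Qed.

Let offdiag_ge0 i j : (0 <= offdiag i j)%E.
Proof. exact: abse_ge0. Qed.

Let diag_le1 i : (d <= 1)%N -> diag i = 0%E.
Proof.
by move=> d1; rewrite /diag dB1_eq0// y_le1// normr0 mul0e mul0r sube0.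
Qed.

Let comp_cases (P : Prop) : (x = 0 \/ (d <= 1)%N -> P) ->
  ((1 < d)%N -> x != 0 -> (exists i, y i 0 = 0) -> P) ->
  ((forall i, y i 0 != 0) -> P) -> P.
Proof.
move=> H1 H2 H3; have [x0|xn0] := eqVneq x 0; first by apply: H1; left.
have [d1|d1] := leqP d 1%N; first by apply: H1; right.
have [/existsP[i /eqP yi]|/existsPn H] := boolP [exists i, y i 0 == 0].
  by apply: H2 => //; exists i.
exact: H3.
Qed.

Let triv thin N sigma : in_scaling x thin N sigma -> x = 0 \/ (d <= 1)%N ->
  kappa thin Comp f x = 0%E.
Proof.
move=> Hin H; apply: (kappa_LN_trivial g eps d_gt0 Hin _ H) => w.
exact: rho_self_comp.
Qed.

Lemma kappa_LN_inf_comp :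
  kappa Linf Comp f x =
    (\big[maxe/-oo]_(i < d)
       ((d%:R - 1)%:E / (d%:R * `|y i 0|)%:E - (`|y i 0| / s)%:E
        + \sum_(j < d | j != i) `|1 / (d%:R * y i 0)%:E + (y j 0 / s)%:E|)
     * (norm_inf x)%:E)%E.
Proof.
have Hin := in_scaling_norm x d_gt0 norm_error_inf.
have [_ rho_in _ _] := Hin.
transitivity (\big[maxe/-oo]_(i < d)
  (diag i + \sum_(j < d | j != i) offdiag i j) * (norm_inf x)%:E)%E => //.
apply: comp_cases => [H|d1 xn0 [i yi]|yn0].
- rewrite (triv Hin H); case: H => [x0|d1].
    by rewrite x0 (is_norm0 (norm_inf_is_norm d)) mule0.
  rewrite (bigmaxe_eq0 i0) ?mul0e// => i.
  by rewrite diag_le1// no_other// addr0.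
- rewrite (kappa_LN_pinfty_comp d_gt0 eps_gt0 g_neq0 Hin d1 xn0 yi).
  rewrite bigmaxe_pinfty.
    by rewrite gt0_mulye// lte_fin (is_norm_gt0 (norm_inf_is_norm d)).
  exists i; rewrite diag_pinfty// addye// gt_eqF//.
  by rewrite (lt_le_trans ltNy0)// sume_ge0.
have Hout := out_scaling_comp eps_gt0 g_neq0 yn0.
rewrite (kappa_LN_rows_inf d_gt0 eps_gt0 rho_in Hout) -/y -/s.
transitivity (\big[maxe/-oo]_(i < d)
   (`|y i 0|^-1 * \sum_j `|ln_mx y s i j| * 1)%:E * (norm_inf x)%:E)%E.
  rewrite (bigmaxe_mulr i0) ?norm_inf_ge0//.
  apply: eq_bigr => i _; congr EFin; rewrite [(\col__ _) _ _]mxE normfV -mulrA.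
  congr (_ * _); rewrite mulr_suml; apply: eq_bigr => j _.
  rewrite mulr1 [const_mx _ _ _]mxE; congr (_ * _).
  by rewrite ger0_norm// norm_inf_ge0.
congr (_ * _)%E; apply: eq_bigr => i _.
rewrite diag_fin//; under [in RHS]eq_bigr do rewrite offdiag_fin//.
rewrite sumEFin -EFinD sum_abs_ln_mx// mulr1 mulrDr mulr_sumr.
by congr (_ + _)%:E; apply: eq_bigr => j _; rewrite mulr1.
Qed.

Lemma kappa_LN_comp_comp :
  kappa Comp Comp f x =
    (\big[maxe/-oo]_(i < d)
       (((d%:R - 1)%:E / (d%:R * `|y i 0|)%:E - (`|y i 0| / s)%:E)
          * `|x i 0|%:E
        + \sum_(j < d | j != i)
            `|1 / (d%:R * y i 0)%:E + (y j 0 / s)%:E| * `|x j 0|%:E))%E.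
Proof.
have Hin := in_scaling_comp x; have [_ rho_in _ x_coord] := Hin.
transitivity (\big[maxe/-oo]_(i < d)
  (diag i * `|x i 0|%:E + \sum_(j < d | j != i) offdiag i j * `|x j 0|%:E))%E => //.
apply: comp_cases => [H|d1 xn0 [i yi]|yn0].
- rewrite (triv Hin H) (bigmaxe_eq0 i0)// => i; case: H => [x0|d1].
    have xE j : `|x j 0| = 0 by rewrite x0 mxE normr0.
    by rewrite xE mule0 big1 ?addr0// => j _; rewrite xE mule0.
  by rewrite diag_le1// mul0e no_other// addr0.
- rewrite (kappa_LN_pinfty_comp d_gt0 eps_gt0 g_neq0 Hin d1 xn0 yi).
  rewrite bigmaxe_pinfty//; exists i.
  have term_ge0 j : (0 <= offdiag i j * `|x j 0|%:E)%E by rewrite mule_ge0.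
  (* If [x i 0 = 0], the diagonal term is [+oo * 0 = 0]. The infinite term of row [i] is therefore
     taken at an index [k] with [x k 0 != 0], on the diagonal or off it. *)
  have [k xk] := x_coord xn0.
  have xk0 : (0 < `|x k 0|%:E)%E by rewrite lte_fin normr_gt0.
  rewrite diag_pinfty//; have [ki|ki] := eqVneq k i.
    rewrite -ki gt0_mulye// addye// gt_eqF//.
    by rewrite (lt_le_trans ltNy0)// sume_ge0// => j _; rewrite ki.
  rewrite (bigD1 k)//= offdiag_pinfty// (gt0_mulye xk0) addye.
    rewrite addey// gt_eqF// (lt_le_trans ltNy0)//.
  by rewrite gt_eqF// (lt_le_trans ltNy0)// sume_ge0.
have Hout := out_scaling_comp eps_gt0 g_neq0 yn0.
rewrite (kappa_LN_rows_inf d_gt0 eps_gt0 rho_in Hout) -/y -/s.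
apply: eq_bigr => i _; rewrite [(\col__ _) _ _]mxE normfV.
rewrite diag_fin//; under [in RHS]eq_bigr do rewrite offdiag_fin// -EFinM.
rewrite sumEFin -EFinM -EFinD sum_abs_ln_mx// mulrDr mulr_sumr.
by congr (_ + _)%:E; [exact: mulrA|apply: eq_bigr => j _; exact: mulrA].
Qed.

Lemma norm_minf_attained (z : 'cV[R]_d) :
  exists2 i, norm_minf z = `|z i 0|%:E & forall j, `|z i 0| <= `|z j 0|.
Proof.
have [i _ H] := @eq_bigmin _ _ _ +oo%E i0 predT (fun j => `|z j 0|%:E) isT
  (fun j _ => leey _).
exists i => // j; rewrite -lee_fin -H; exact: bigmin_le.
Qed.

Let row2E i : y i 0 != 0 ->
  `|y i 0|^-1 * Num.sqrt (1 - d%:R^-1 - (1 + eps / s) * (y i 0 ^+ 2 / s)) =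
  Num.sqrt ((d%:R - 1) / (d%:R * `|y i 0| ^+ 2) - (1 + eps / s) * (1 / s)).
Proof.
move=> yi; have ayi : `|y i 0| != 0 by rewrite normr_eq0.
have ayi0 : 0 <= `|y i 0|^-1 by rewrite invr_ge0.
rewrite -[X in X * _](ger0_norm ayi0) -sqrtr_sqr.
rewrite -sqrtrM ?sqr_ge0//; congr Num.sqrt.
rewrite -[y i 0 ^+ 2](real_normK (num_real (y i 0))).
move: ayi; move: `|y i 0| => a a0.
by field; rewrite d_neq0 a0 gt_eqF.
Qed.

(** After division by the modulus of [y i 0], the radicand of row [i] decreases weakly as that
    modulus grows. The maximum over rows thus sits at the smallest entry of [y], which is where
    [norm_minf] comes from. *)
Lemma kappa_LN_2_comp :
  kappa (Lp 2) Comp f x =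
    (sqrte ((d%:R - 1)%:E / (d%:R%:E * norm_minf y ^+ 2)
            - ((1 + eps / s) * (1 / s))%:E)
     * (norm2 x)%:E)%E.
Proof.
have Hin := in_scaling_norm x d_gt0 norm_error_2.
have [_ rho_in _ _] := Hin; have [k -> ymin] := norm_minf_attained y.
apply: comp_cases => [H|d1 xn0 [i yi]|yn0].
- rewrite (triv Hin H); case: H => [x0|d1].
    by rewrite x0 (is_norm0 (norm2_is_norm d)) mule0.
  (* For [d = 1] the radicand is negative, and its root is 0 by convention, in agreement with the
     vanishing output error. *)
  rewrite dB1_eq0// mul0e sub0e /= ler0_sqrtr ?mul0e//.
  by rewrite oppr_le0 mulr_ge0 ?addr_ge0 ?divr_ge0// ltW.
- rewrite (kappa_LN_pinfty_comp d_gt0 eps_gt0 g_neq0 Hin d1 xn0 yi).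
  have -> : `|y k 0| = 0.
    by apply/eqP; rewrite eq_le normr_ge0 andbT; have := ymin i; rewrite yi normr0.
  rewrite expe2 mule0 mule0 inve0 gt0_muley ?lte_fin ?subr_gt0 ?ltr1n//.
  by rewrite addye//= gt0_mulye// lte_fin (is_norm_gt0 (norm2_is_norm d)).
have Hout := out_scaling_comp eps_gt0 g_neq0 yn0.
rewrite (kappa_LN_rows_2 d_gt0 eps_gt0 (norm2_ge0 x) rho_in Hout) -/y -/s.
pose F i := Num.sqrt ((d%:R - 1) / (d%:R * `|y i 0| ^+ 2) - (1 + eps / s) * (1 / s)).
have -> : ((d%:R - 1)%:E / (d%:R%:E * `|y k 0|%:E ^+ 2) =
    ((d%:R - 1) / (d%:R * `|y k 0| ^+ 2))%:E)%E.
  rewrite expe2 -!EFinM -expr2 inver mulf_eq0 (negbTE d_neq0)/=.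
  by rewrite expf_eq0/= normr_eq0 (negbTE (yn0 k)).
rewrite -EFinB [sqrte _]/= -/(F k).
have E (a b c : R) : a * (b * c) = a * c * b by ring.
transitivity (\big[maxe/-oo%E]_(i < d) (F i * norm2 x)%:E).
  apply: eq_bigr => i _; congr EFin; rewrite [(\col__ _) _ _]mxE normfV.
  by rewrite /F -(row2E (yn0 i)); exact: E.
rewrite -(bigmaxe_mulr i0 F (norm2_ge0 x)).
have [i -> Fi] := bigmaxe_attained i0 F.
congr (_%:E * _)%E; apply/eqP; rewrite eq_le Fi andbT.
apply: ler_wsqrtr; rewrite lerD2r; apply: ler_wpM2l.
  by rewrite subr_ge0 ler1n.
have ay j : 0 < `|y j 0| by rewrite normr_gt0.
rewrite lef_pV2 ?posrE; last 2 first.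
- by rewrite mulr_gt0 ?ltr0n// exprn_gt0.
- by rewrite mulr_gt0 ?ltr0n// exprn_gt0.
by rewrite ler_wpM2l// lerXn2r ?nnegrE.
Qed.

End ComponentwiseOutput.

Theorem theorem3p2 (R : realType) (d : nat) (d_gt0 : (0 < d)%N)
    (g : 'cV[R]_d) (g_neq0 : forall i : 'I_d, g i 0 != 0)
    (eps : R) (eps_gt0 : 0 < eps) (x : 'cV[R]_d) :
  let f : 'cV[R]_d -> 'cV[R]_d := LN g eps in
  let y : 'cV[R]_d := centered x in
  let s : R := norm2 y ^+ 2 + eps in
  let gy : 'cV[R]_d := hadamard g y in
  let B22 : \bar R := ((norm_inf g * norm2 x)%:E / (norm2 gy)%:E)%E in
  let Binf2 : \bar R :=
    (\big[maxe/-oo]_(b : {ffun 'I_d -> bool})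
       (Num.sqrt (d%:R - dot (signs b) ones ^+ 2 / d%:R
          - (1 + eps / s) * (dot (signs b) y ^+ 2 / s)))%:E
     * ((norm_inf g * norm_inf x)%:E / (norm2 gy)%:E))%E in
  let Bc2 : \bar R :=
    (\big[maxe/-oo]_(b : {ffun 'I_d -> bool})
       (Num.sqrt (norm2 x ^+ 2 - dot (signs b) x ^+ 2 / d%:R
          - (1 + eps / s) * (dot (signs b) (hadamard y x) ^+ 2 / s)))%:E
     * ((norm_inf g)%:E / (norm2 gy)%:E))%E in
  [/\ (kappa (Lp 2) (Lp 2) f x <= B22)%E,
      kappa (Lp 2) Linf f x =
        (\big[maxe/-oo]_(i < d)
           (`|g i 0| * Num.sqrt (1 - d%:R^-1
              - (1 + eps / s) * (y i 0 ^+ 2 / s)))%:E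
         * ((norm2 x)%:E / (norm_inf gy)%:E))%E,
      (kappa Linf (Lp 2) f x <= Binf2)%E
    & kappa Linf Linf f x =
        (\big[maxe/-oo]_(i < d)
           (`|g i 0| * (1 - d%:R^-1 - y i 0 ^+ 2 / s
              + \sum_(j < d | j != i) `|d%:R^-1 + y i 0 * y j 0 / s|))%:E
         * ((norm_inf x)%:E / (norm_inf gy)%:E))%E]
  /\
  [/\ kappa Comp Linf f x =
        (\big[maxe/-oo]_(i < d)
           (`|g i 0| * ((1 - d%:R^-1 - y i 0 ^+ 2 / s) * `|x i 0|
              + \sum_(j < d | j != i)
                  `|d%:R^-1 + y i 0 * y j 0 / s| * `|x j 0|))%:E
         * (1 / (norm_inf gy)%:E))%E,
      kappa Linf Comp f x =
        (\big[maxe/-oo]_(i < d)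
           ((d%:R - 1)%:E / (d%:R * `|y i 0|)%:E - (`|y i 0| / s)%:E
            + \sum_(j < d | j != i)
                `|1 / (d%:R * y i 0)%:E + (y j 0 / s)%:E|)
         * (norm_inf x)%:E)%E,
      (kappa Comp (Lp 2) f x <= Bc2)%E
    & kappa (Lp 2) Comp f x =
        (sqrte ((d%:R - 1)%:E / (d%:R%:E * norm_minf y ^+ 2)
                - ((1 + eps / s) * (1 / s))%:E)
         * (norm2 x)%:E)%E]
  /\
  kappa Comp Comp f x =
    (\big[maxe/-oo]_(i < d)
       (((d%:R - 1)%:E / (d%:R * `|y i 0|)%:E - (`|y i 0| / s)%:E)
          * `|x i 0|%:E
        + \sum_(j < d | j != i)
            `|1 / (d%:R * y i 0)%:E + (y j 0 / s)%:E| * `|x j 0|%:E))%E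
  /\
  (forall c : R, g = c *: ones ->
     [/\ (* The equality fails in exactly the remaining cases: for d = 2 and
            y != 0 the left side is (eps / s) * B22 with 0 < B22 < +oo; for
            d = 1 and x != 0 the left side is 0 and the right side +oo. *)
         (2 < d)%N \/ (d = 2%N /\ y = 0) \/ x = 0 ->
           kappa (Lp 2) (Lp 2) f x = B22,
         kappa Linf (Lp 2) f x = Binf2
       & kappa Comp (Lp 2) f x = Bc2]).

Proof.
move=> f y s gy B22 Binf2 Bc2.
have sE : s = \sum_j y j 0 ^+ 2 + eps by congr (_ + _); exact: norm2_sqr.
have Bc2E : Bc2 = (\big[maxe/-oo]_(b : {ffun 'I_d -> bool})
       (Num.sqrt (\sum_i x i 0 ^+ 2 - dot (signs b) x ^+ 2 / d%:R
          - (1 + eps / s) * (dot (signs b) (hadamard y x) ^+ 2 / s)))%:E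
     * ((norm_inf g)%:E / (norm2 gy)%:E))%E.
  by rewrite /Bc2; have -> := norm2_sqr x.
move: Bc2 Bc2E => Bc2 ->; rewrite /B22 /Binf2; clear B22 Binf2 Bc2.
move: s sE => s ->.
have [k22 k22E] := kappa_LN_2_2 x d_gt0 eps_gt0 g_neq0.
have [ki2 ki2E] := kappa_LN_inf_2 x d_gt0 eps_gt0 g_neq0.
have [kc2 kc2E] := kappa_LN_comp_2 x d_gt0 eps_gt0 g_neq0.
split; [|split; [|split]].
- split; [exact: k22|exact: kappa_LN_2_inf|exact: ki2|exact: kappa_LN_inf_inf].
- split; [exact: kappa_LN_comp_inf|exact: kappa_LN_inf_comp|exact: kc2|].
  exact: kappa_LN_2_comp.
- exact: kappa_LN_comp_comp.
- move=> c gE; split; [exact: k22E gE|exact: ki2E gE|exact: kc2E gE].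
Qed.
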